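(* Let $N\geq 2$, let $G\subset\mathbb{R}^N$ be a connected open set, let $k$ be a real constant, and let $v$ be a nontrivial (i.e. not identically zero) real valued solution to the Helmholtz equation $\Delta v+k^2v=0$ in $G$. Then the nodal domains of $v$ in $G$ can be ordered as a (finite or infinite) sequence $A_1,A_2,\ldots,A_n,\ldots$, containing every nodal domain of $v$ in $G$ exactly once, in such a way that for any $j\geq 2$ (for which $A_j$ is defined) there exist an index $i$ with $1\leq i<j$ and a regular portion $\Sigma_j$ of the nodal set $\mathcal{N}_v$ such that $$\Sigma_j\subset\partial A_i\cap\partial A_j.$$
   Context: The nodal set of $v$ is $\mathcal{N}_v=\{x\in G:\ v(x)=0\}$. The set of nodal critical points of $v$ is $\mathcal{C}_v=\{x\in G:\ v(x)=0\text{ and }\nabla v(x)=0\}$. A subset $\Sigma\subset\mathcal{N}_v$ is called a regular portion of $\mathcal{N}_v$ if it is a (nonempty) analytic, open and connected hypersurface (i.e. an $(N-1)$-dimensional real analytic embedded hypersurface of $\mathbb{R}^N$ without boundary, relatively open in $\mathcal{N}_v$) contained in $\mathcal{N}_v\setminus\mathcal{C}_v$. The nodal domains of $v$ in $G$ are the connected components of the open set $\{x\in G:\ v(x)\neq 0\}=G\setminus\mathcal{N}_v$. The symbol $\partial A$ denotes the topological boundary of $A$. *)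

(* Defs.v *)
From HB Require Import structures.
From mathcomp Require Import all_boot all_order all_algebra.
From mathcomp Require Import all_classical all_reals all_analysis.
From mathcomp.analysis.showcase Require summability.

Set Implicit Arguments.
Unset Strict Implicit.
Unset Printing Implicit Defensive.

Import Order.TTheory GRing.Theory Num.Theory.
Import numFieldNormedType.Exports.

Local Open Scope classical_set_scope.
Local Open Scope ring_scope.

(* Functions on a set G are represented by total functions 'rV[R]_N -> R.
   When G is open, everything below depends only on their values on G. *)

Definition partial (R : realType) (N : nat) (i : 'I_N) (f : 'rV[R]_N -> R)
  : 'rV[R]_N -> R := fun x => 'D_(delta_mx 0 i) f x.

Definition grad (R : realType) (N : nat) (f : 'rV[R]_N -> R) (x : 'rV[R]_N)
  : 'rV[R]_N := \row_i partial i f x.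

Definition laplacian (R : realType) (N : nat) (f : 'rV[R]_N -> R)
  (x : 'rV[R]_N) : R := \sum_(i < N) partial i (partial i f) x.

(* All partial derivatives of order at most n exist and are continuous at the
   points of G; meant for G open. *)
Fixpoint class_C (R : realType) (N : nat) (n : nat) (G : set 'rV[R]_N)
    (f : 'rV[R]_N -> R) : Prop :=
  (forall x, G x -> {for x, continuous f}) /\
  if n is m.+1 then
    forall i : 'I_N, (forall x, G x -> derivable f x (delta_mx 0 i)) /\
                     class_C m G (partial i f)
  else True.

Definition helmholtz_solution (R : realType) (N : nat) (G : set 'rV[R]_N)
    (k : R) (v : 'rV[R]_N -> R) : Prop :=
  class_C 2 G v /\ forall x, G x -> laplacian v x + k ^+ 2 * v x = 0.

Definition nodal_set (R : realType) (N : nat) (G : set 'rV[R]_N)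
    (v : 'rV[R]_N -> R) : set 'rV[R]_N :=
  [set x | G x /\ v x = 0].

Definition nodal_critical_set (R : realType) (N : nat) (G : set 'rV[R]_N)
    (v : 'rV[R]_N -> R) : set 'rV[R]_N :=
  [set x | [/\ G x, v x = 0 & grad v x = 0]].

Definition nodal_domain (R : realType) (N : nat) (G : set 'rV[R]_N)
    (v : 'rV[R]_N -> R) (A : set 'rV[R]_N) : Prop :=
  exists2 x, (G `\` nodal_set G v) x &
             A = connected_component (G `\` nodal_set G v) x.

Definition boundary (T : topologicalType) (A : set T) : set T :=
  closure A `\` interior A.

(* A multi-index is a finite function 'I_N -> nat. *)
Definition monomial (R : realType) (N : nat) (alpha : {ffun 'I_N -> nat})
  (x : 'rV[R]_N) : R := \prod_(i < N) x 0 i ^+ alpha i.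

(* Near every point of U, f is the sum of a power series in N variables. The
   series is summed as an unordered family (limit of the finite partial sums
   along inclusion), which for real families is absolute convergence. *)
Definition analytic_on (R : realType) (N : nat) (U : set 'rV[R]_N)
    (f : 'rV[R]_N -> R) : Prop :=
  forall a, U a ->
  exists c : {ffun 'I_N -> nat} -> R,
    \forall x \near a,
      summability.partial_sum (fun alpha => c alpha * monomial alpha (x - a))
        @ summability.totally --> f x.

(* Real analytic embedded hypersurface without boundary: locally the zero set
   of a real analytic function whose gradient does not vanish on it. *)
Definition analytic_hypersurface (R : realType) (N : nat)
    (S : set 'rV[R]_N) : Prop :=
  forall x, S x -> exists (U : set 'rV[R]_N) (phi : 'rV[R]_N -> R),
    [/\ open U, U x, analytic_on U phi,
        S `&` U = [set y | U y /\ phi y = 0] &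
        forall y, (S `&` U) y -> grad phi y != 0].

Definition regular_portion (R : realType) (N : nat) (G : set 'rV[R]_N)
    (v : 'rV[R]_N -> R) (S : set 'rV[R]_N) : Prop :=
  [/\ S !=set0,
      analytic_hypersurface S,
      connected S,
      (exists O, open O /\ S = nodal_set G v `&` O) &
      S `<=` nodal_set G v `\` nodal_critical_set G v].

(* The index sets of finite or infinite sequences numbered from 1. *)
Definition sequence_index_set (J : set nat) : Prop :=
  J = [set n | (1 <= n)%N] \/ exists m : nat, J = [set n | (1 <= n <= m)%N].

(* Main.v *)
(* Gradient estimate: comparing the odd part of u in the direction e_i on a half
   cube with a quadratic barrier bounds |u(a + t e_i) - u(a - t e_i)| by a multiple
   of t sup |u|. This only needs the second difference quotients of u to converge
   to -k^2 u, a condition that is linear and translation invariant; applied to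
   double difference quotients it shows that the partial derivatives of a solution
   are again solutions, and its iterates bound the derivatives of order m by
   (C m)^m sup |u|, hence u is analytic and vanishes to infinite order nowhere.

   At a zero with nonzero gradient the nodal set is a graph, with one nodal domain
   on each side, so the graph gives an edge between these domains. It remains to
   see that the domains form a connected graph under this adjacency: they are
   countably many, and can then be listed greedily. Suppose that a family P of
   domains has no edge to its complement, and call a point of G good if near it
   only domains of P, or only domains outside P, occur. By induction on the order of
   vanishing m every point is good: if m >= 2, some derivative w of order m - 2
   vanishes at the point but has a nonzero Hessian there, which is traceless and
   hence has a nonzero principal 2 x 2 minor, for coordinates i and j. Nearby bad
   points are zeros of d_i w and d_j w, so every (i, j)-plane section of a small cube
   contains at most one of them; they do not disconnect the cube. As G is
   connected and the zeros of u have empty interior, P is everything or empty. *)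
Require Import Defs.
From HB Require Import structures.
From mathcomp Require Import all_boot all_order all_algebra.
From mathcomp Require Import all_classical all_reals all_analysis.
From mathcomp Require Import finmap.
From mathcomp.analysis.showcase Require summability.
From mathcomp Require Import ring lra.
Import Order.TTheory GRing.Theory Num.Theory.
Import numFieldNormedType.Exports.
Local Open Scope classical_set_scope.
Local Open Scope ring_scope.

Set Implicit Arguments.
Unset Strict Implicit.
Unset Printing Implicit Defensive.

(** A solution is only known to be of class C^2, so its equation cannot be differentiated at the
    outset. Difference quotients, in contrast, remain weak solutions whatever the regularity, and
    the gradient estimate turns their uniform convergence into one more derivative. The maximum
    principle behind it uses only that second differences are nonpositive at an interior maximum; no
    integral, mean value formula or fundamental solution occurs.

    The topological obstacle is that critical zeros might separate the domains. Their dimension is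
    never estimated. Near a point of order m, a point where [d_i w] or [d_j w] is nonzero has order
    at most m - 1 and is good by induction; this is why bad points are common zeros of both. A
    principal minor is required because it is the Jacobian of ([d_i w], [d_j w]) restricted to an
    (i, j)-plane, and two directions are required because one point does not disconnect a rectangle,
    while it does cut a segment. *)

Definition cube (R : realType) (N : nat) (a : 'rV[R]_N) (d : R) : set 'rV[R]_N :=
  [set y | forall j, `|y 0 j - a 0 j| <= d].

Notation basis i := (delta_mx 0 i).

(** * Closed cubes as a basis of neighbourhoods *)

Section Cubes.
Variables (R : realType) (N : nat).
Implicit Types (a x y : 'rV[R]_N) (d e h t : R) (f u : 'rV[R]_N -> R).

Lemma shiftE a t (i j : 'I_N) :
  (a + t *: basis i) 0 j = a 0 j + (if j == i then t else 0).
Proof. by rewrite !mxE eqxx /=; case: (j == i); rewrite ?mulr1 ?mulr0. Qed.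

Lemma cube_center a d : 0 <= d -> cube a d a.
Proof. by move=> d0 j; rewrite subrr normr0. Qed.

Lemma cubeS a d e : d <= e -> cube a d `<=` cube a e.
Proof. by move=> de x xd j; apply: le_trans (xd j) de. Qed.

Lemma cube_trans a b d e x : cube a d b -> cube b e x -> cube a (d + e) x.
Proof.
move=> ab bx j; have -> : x 0 j - a 0 j = (b 0 j - a 0 j) + (x 0 j - b 0 j) by ring.
by apply: le_trans (ler_normD _ _) _; apply: lerD.
Qed.

Lemma cube_shift a t i : cube a `|t| (a + t *: basis i).
Proof.
by move=> j; rewrite shiftE addrC addKr; case: ifP => // _; rewrite normr0.
Qed.

Lemma nbhs_cubeP a (P : set 'rV[R]_N) :
  nbhs a P <-> exists2 d, 0 < d & cube a d `<=` P.
Proof.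
split.
  move/nbhs_ballP => [e /= e0 eP]; exists (e / 2); first by lra.
  move=> y yd; apply: eP; split=> // i j; rewrite !ord1 /ball /= distrC.
  by apply: le_lt_trans (yd j) _; lra.
case=> d d0 dP; apply/nbhs_ballP; exists d => //= y yd; apply: dP => j.
by case: yd => _ /(_ 0 j); rewrite /ball /= distrC => /ltW.
Qed.

Lemma nbhs_cube a d : 0 < d -> nbhs a (cube a d).
Proof. by move=> d0; apply/nbhs_cubeP; exists d. Qed.

Lemma open_cubeP (G : set 'rV[R]_N) a : open G -> G a ->
  exists2 d, 0 < d & cube a d `<=` G.
Proof. by move=> Go Ga; apply/nbhs_cubeP; exact: open_nbhs_nbhs. Qed.

Lemma open_of_cube (G : set 'rV[R]_N) :
  (forall a, G a -> exists2 d, 0 < d & cube a d `<=` G) -> open G.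
Proof.
move=> h; rewrite openE => a /h ?; exact/nbhs_cubeP.
Qed.

Lemma continuous_cubeP f x : {for x, continuous f} <->
  forall e, 0 < e -> exists2 d, 0 < d & forall y, cube x d y -> `|f y - f x| < e.
Proof.
split.
  move=> fx e e0; have /nbhs_cubeP[d d0 dP] :
    nbhs x (f @^-1` ball (f x) e) by apply: fx; exact: nbhsx_ballx.
  by exists d => // y /dP; rewrite /ball /= distrC.
move=> h P /nbhs_ballP[e /= e0 eP]; have [d d0 dP] := h e e0.
by apply/nbhs_cubeP; exists d => // y /dP; rewrite distrC => ?; exact: eP.
Qed.

Lemma compact_cube a d : compact (cube a d).
Proof.
have := @rV_compact R N (fun j => `[a 0 j - d, a 0 j + d]%classic)
  (fun j => @segment_compact R _ _).
congr compact; apply/seteqP; split => x /= h j; move: (h j);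
  rewrite /= in_itv /= ler_distl //.
Qed.

End Cubes.

(** * Mean value theorem and second differences along coordinate lines *)

Section Lines.
Variables (R : realType) (N : nat).
Implicit Types (a x y : 'rV[R]_N) (d e h t : R) (f u : 'rV[R]_N -> R).

(** Stated on the symmetric interval |t| <= |h|, so that both signs of h and h = 0 are served by one
    statement. *)
Lemma MVT0 (g dg : R -> R) (h : R) :
  (forall t, `|t| <= `|h| -> is_derive t 1 g (dg t)) ->
  exists2 c, `|c| <= `|h| & g h - g 0 = dg c * h.
Proof.
move=> gd.
have wc (a b : R) : (forall t, t \in `[a, b] -> `|t| <= `|h|) ->
    {within `[a, b], continuous g}.
  move=> ab; apply: derivable_within_continuous => t /ab /gd ?.
  exact: ex_derive.
case: (ltrgtP h 0) => h0.
- have sub t : t \in `[h, 0] -> `|t| <= `|h|.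
    by rewrite in_itv /= => /andP[? ?]; rewrite ler0_norm // ltr0_norm //; lra.
  have D t : t \in `]h, 0[ -> is_derive t 1 g (dg t).
    by move/subset_itv_oo_cc/sub; exact: gd.
  have [c ch e] := MVT h0 D (wc _ _ sub).
  exists c; first by apply: sub; exact: subset_itv_oo_cc.
  by rewrite -opprB e; ring.
- have sub t : t \in `[0, h] -> `|t| <= `|h|.
    by rewrite in_itv /= => /andP[? ?]; rewrite ger0_norm // gtr0_norm.
  have D t : t \in `]0, h[ -> is_derive t 1 g (dg t).
    by move/subset_itv_oo_cc/sub; exact: gd.
  have [c ch e] := MVT h0 D (wc _ _ sub).
  exists c; first by apply: sub; exact: subset_itv_oo_cc.
  by rewrite e; ring.
- by exists 0; rewrite ?h0 ?normr0 // subrr mulr0.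
Qed.

Lemma is_derive_line f a t i : derivable f (a + t *: basis i) (basis i) ->
  is_derive t 1 (fun s => f (a + s *: basis i)) (partial i f (a + t *: basis i)).
Proof.
move=> fd.
have E : (fun h => h^-1 *: (f (a + (h *: 1 + t) *: basis i) - f (a + t *: basis i)))
  = (fun h => h^-1 *: (f (h *: basis i + (a + t *: basis i)) - f (a + t *: basis i))).
  apply/funext => h; congr (_ *: (f _ - _)).
  by rewrite [h *: 1]mulr1 scalerDl addrCA.
by split; rewrite /derivable /partial /derive /= E.
Qed.

Lemma MVT_line f a h i :
  (forall t, `|t| <= `|h| -> derivable f (a + t *: basis i) (basis i)) ->
  exists2 c, `|c| <= `|h| &
    f (a + h *: basis i) - f a = h * partial i f (a + c *: basis i).
Proof.
move=> fd.
have [|c ch] := @MVT0 (fun s => f (a + s *: basis i))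
    (fun s => partial i f (a + s *: basis i)) h.
  by move=> t /fd; exact: is_derive_line.
by rewrite scale0r addr0 => ->; exists c => //; rewrite mulrC.
Qed.

(** Left undivided by h^2: identities stay polynomial and h = 0 is no exception. *)
Definition sdiff f x (j : 'I_N) h : R :=
  f (x + h *: basis j) + f (x + (- h) *: basis j) - 2 * f x.

Lemma is_derive_flip (g : R -> R) t l :
  is_derive (- t) 1 g l -> is_derive t 1 (fun s => g (- s)) (- l).
Proof.
move=> gd; have dN : is_derive t (1:R) (fun s : R => - s) (- 1).
  exact: is_deriveN.
have := @is_derive1_comp R g (fun s => - s) t l (-1) gd dN.
by rewrite mulrN1.
Qed.

Lemma norm_mean_le (p q l e : R) :
  `|p - l| < e / 2 -> `|q - l| < e / 2 -> `|p + q - 2 * l| <= e.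
Proof.
move=> p1 q1; have -> : p + q - 2 * l = (p - l) + (q - l) by ring.
by apply: le_trans (ler_normD _ _) _; lra.
Qed.

Lemma sdiff_expansion f x j :
  (\forall y \near x, derivable f y (basis j)) ->
  (\forall y \near x, derivable (partial j f) y (basis j)) ->
  {for x, continuous (partial j (partial j f))} ->
  forall e, 0 < e -> exists2 d, 0 < d & forall h, `|h| <= d ->
    `|sdiff f x j h - h ^+ 2 * partial j (partial j f) x| <= e * h ^+ 2.
Proof.
move=> /nbhs_cubeP[d1 d10 H1] /nbhs_cubeP[d2 d20 H2] /continuous_cubeP C e e0.
have e4 : 0 < e / 2 by lra.
have [d3 d30 H3] := C _ e4.
pose d := Num.min d1 (Num.min d2 d3).
have d0 : 0 < d by rewrite !lt_min d10 d20 d30.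
exists d => // h hd.
have dle t : `|t| <= `|h| -> [/\ `|t| <= d1, `|t| <= d2 & `|t| <= d3].
  by move=> th; have := le_trans th hd; rewrite !le_min => /and3P[].
have cu t : cube x `|t| (x + t *: basis j) by exact: cube_shift.
set L := partial j (partial j f) x.
(* Subtracting t^2 L leaves a function whose first derivative vanishes at 0 by symmetry and whose
   second derivative is small near 0; two applications of the mean value theorem finish. *)
pose g t := f (x + t *: basis j) + f (x + (- t) *: basis j) - t ^+ 2 * L.
pose dg t := partial j f (x + t *: basis j) - partial j f (x + (- t) *: basis j) - 2 * t * L.
have [t th|c ch E] := @MVT0 g dg h.
  have [t1 t2 t3] := dle _ th.
  have A1 : is_derive t 1 (fun s => f (x + s *: basis j)) (partial j f (x + t *: basis j)).
    by apply: is_derive_line; apply: H1; apply: cubeS (cu t).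
  have A2 : is_derive t 1 (fun s => f (x + (- s) *: basis j))
     (- partial j f (x + (- t) *: basis j)).
    apply: (@is_derive_flip (fun s => f (x + s *: basis j))).
    by apply: is_derive_line; apply: H1; apply: cubeS (cu _); rewrite normrN.
  have A3 : is_derive t 1 (fun s : R => s ^+ 2 * L) (2 * t * L).
    apply: is_derive_eq; rewrite /GRing.scale /=; ring.
  by rewrite /g /dg; apply: is_derive_eq.
pose ddg t := partial j (partial j f) (x + t *: basis j)
  + partial j (partial j f) (x + (- t) *: basis j) - 2 * L.
have [t tc|c' cc' E'] := @MVT0 dg ddg c.
  have [t1 t2 t3] := dle _ (le_trans tc ch).
  have A1 : is_derive t 1 (fun s => partial j f (x + s *: basis j))
      (partial j (partial j f) (x + t *: basis j)).
    by apply: is_derive_line; apply: H2; apply: cubeS (cu t).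
  have A2 : is_derive t 1 (fun s => partial j f (x + (- s) *: basis j))
     (- partial j (partial j f) (x + (- t) *: basis j)).
    apply: (@is_derive_flip (fun s => partial j f (x + s *: basis j))).
    by apply: is_derive_line; apply: H2; apply: cubeS (cu _); rewrite normrN.
  have A3 : is_derive t 1 (fun s : R => 2 * s * L) (2 * L).
    apply: is_derive_eq; rewrite /GRing.scale /=; ring.
  by have := is_deriveB (is_deriveB A1 A2) A3; rewrite opprK.
have g0 : g 0 = 2 * f x by rewrite /g oppr0 scale0r addr0; ring.
have dg0 : dg 0 = 0 by rewrite /dg oppr0 scale0r addr0; ring.
have -> : sdiff f x j h - h ^+ 2 * L = ddg c' * c * h.
  by rewrite -[ddg c' * c]E' dg0 subr0 -E g0 /sdiff /g; ring.
have B : `|ddg c'| <= e.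
  have [_ _ t3] := dle _ (le_trans cc' ch).
  have B1 := H3 _ (cubeS t3 (cu c')).
  have B2 : cube x d3 (x + (- c') *: basis j) by apply: cubeS (cu _); rewrite normrN.
  have {}B2 := H3 _ B2.
  exact: norm_mean_le B1 B2.
rewrite !normrM -mulrA -real_normK ?num_real // expr2.
by apply: ler_pM => //; rewrite ?mulr_ge0 // ler_wpM2r.
Qed.
End Lines.
(** The Laplace operator is read through second differences with one common step h in all
    directions. No derivative of u is assumed, and the admissible size of h may depend on the point
    x. *)
Definition weak_helmholtz (R : realType) (N : nat) (k : R) (G : set 'rV[R]_N)
    (u : 'rV[R]_N -> R) : Prop :=
  (forall x, G x -> {for x, continuous u}) /\
  forall x, G x -> forall e, 0 < e -> exists2 d, 0 < d & forall h, `|h| <= d ->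
    `|\sum_(j < N) sdiff u x j h + k ^+ 2 * u x * h ^+ 2| <= e * h ^+ 2.

(** * The weak Helmholtz equation *)

Section Comparison.
Variables (R : realType) (N : nat).
Implicit Types (a x y : 'rV[R]_N) (d e h t k : R) (f u : 'rV[R]_N -> R).

Lemma coord_continuous_at (i : 'I_N) (x : 'rV[R]_N) :
  {for x, continuous (fun y : 'rV[R]_N => y 0 i)}.
Proof.
apply/continuous_cubeP => e e0; exists (e / 2); first by lra.
by move=> y /(_ i) h; lra.
Qed.

Lemma uniform_radius (I : finType) (P : I -> R -> Prop) :
  (forall i, exists2 d, 0 < d & P i d) ->
  (forall i d d', d' <= d -> P i d -> P i d') ->
  exists2 d, 0 < d & forall i, P i d.
Proof.
move=> H mono.
have /choice[r rP] : forall i, exists d, 0 < d /\ P i d.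
  by move=> i; have [d] := H i; exists d.
exists (\big[Num.min/1]_i r i).
  by apply/bigmin_gtP; split => // i _; exact: (rP i).1.
by move=> i; apply: mono (rP i).2; exact: bigmin_le_cond.
Qed.

Lemma sdiffD f u x j h : sdiff (fun y => f y + u y) x j h = sdiff f x j h + sdiff u x j h.
Proof. by rewrite /sdiff; ring. Qed.

Lemma sdiffZ c f x j h : sdiff (fun y => c * f y) x j h = c * sdiff f x j h.
Proof. by rewrite /sdiff; ring. Qed.

Lemma weak_helmholtz_lin k (G : set 'rV[R]_N) f u c d :
  weak_helmholtz k G f -> weak_helmholtz k G u ->
  weak_helmholtz k G (fun y => c * f y + d * u y).
Proof.
move=> [fc fh] [uc uh]; split.
  move=> x Gx; apply: (@continuousD _ _ _ (fun y => c * f y) (fun y => d * u y)).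
    by apply: continuousM; [exact: cst_continuous|exact: fc].
  by apply: continuousM; [exact: cst_continuous|exact: uc].
move=> x Gx e e0; pose m := `|c| + `|d| + 1.
have m0 : 0 < m by rewrite /m; have := normr_ge0 c; have := normr_ge0 d; lra.
have em : 0 < e / m by exact: divr_gt0.
have [d1 d10 H1] := fh x Gx _ em; have [d2 d20 H2] := uh x Gx _ em.
exists (Num.min d1 d2); first by rewrite lt_min d10.
move=> h; rewrite le_min => /andP[/H1 {}H1 /H2 {}H2].
under eq_bigr do rewrite sdiffD !sdiffZ.
rewrite big_split /= -!mulr_sumr.
set A := \sum_j _ in H1 *; set B := \sum_j _ in H2 *.
rewrite (_ : _ + _ + _ = c * (A + k ^+ 2 * f x * h ^+ 2) + d * (B + k ^+ 2 * u x * h ^+ 2)); last by ring.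
apply: le_trans (ler_normD _ _) _; rewrite !normrM.
have -> : e * h ^+ 2 = m * (e / m * h ^+ 2) by field; lra.
have : `|c| * `|A + k ^+ 2 * f x * h ^+ 2| <= `|c| * (e / m * h ^+ 2) by rewrite ler_wpM2l.
have : `|d| * `|B + k ^+ 2 * u x * h ^+ 2| <= `|d| * (e / m * h ^+ 2) by rewrite ler_wpM2l.
have : 0 <= e / m * h ^+ 2 by rewrite mulr_ge0 ?sqr_ge0 // ltW.
by rewrite /m !mulrDl mul1r; lra.
Qed.

Lemma weak_helmholtz_shift k (G G' : set 'rV[R]_N) u a :
  weak_helmholtz k G u -> (forall y, G' y -> G (y + a)) ->
  weak_helmholtz k G' (fun y => u (y + a)).
Proof.
move=> [uc uh] GG'; split.
  move=> x /GG' /uc /continuous_cubeP C; apply/continuous_cubeP => e /C[d d0 dC].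
  exists d => // y yd; apply: dC => j; rewrite !mxE.
  by have -> : y 0 j + a 0 j - (x 0 j + a 0 j) = y 0 j - x 0 j by ring.
move=> x /GG' /uh H e /H[d d0 {}H]; exists d => // h /H.
congr (`|_ + _| <= _); apply: eq_bigr => j _.
by rewrite /sdiff (addrAC x a (h *: _)) (addrAC x a ((- h) *: _)).
Qed.

Lemma helmholtz_weak k (G : set 'rV[R]_N) u : open G ->
  helmholtz_solution G k u -> weak_helmholtz k G u.
Proof.
move=> Go [[uc u1] uh]; split=> // x Gx e e0.
have nG : nbhs x G by exact: open_nbhs_nbhs.
(* The error is shared among N directions; the extra 1 keeps the divisor positive. *)
pose m : R := N%:R + 1.
have m0 : 0 < m by rewrite /m; have := @ler0n R N; lra.
have H j : exists2 d, 0 < d & forall h, `|h| <= d ->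
    `|sdiff u x j h - h ^+ 2 * partial j (partial j u) x| <= e / m * h ^+ 2.
  have [ud [pc pd]] := u1 j.
  apply: sdiff_expansion; last exact: divr_gt0.
  - by apply: filterS nG => y; exact: ud.
  - by apply: filterS nG => y; apply: (pd j).1.
  - by apply: (pd j).2.1.
have [|d d0 F] := uniform_radius H.
  by move=> j d d' dd' P h /le_trans h'; apply: P; exact: h'.
exists d => // h hd; have {}F j := F j h hd.
have /eqP := uh x Gx; rewrite addr_eq0 /laplacian => /eqP L.
rewrite -[k ^+ 2 * _]opprK -L mulNr mulr_suml -sumrB.
apply: le_trans (ler_norm_sum _ _ _) _.
apply: le_trans (_ : \sum_(j < N) (e / m * h ^+ 2) <= _).
  by apply: ler_sum => j _; rewrite [X in _ - X]mulrC.
rewrite sumr_const card_ord -[X in X <= _]mulr_natr.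
have -> : e / m * h ^+ 2 * N%:R = e * h ^+ 2 * (N%:R / m) by ring.
rewrite -[X in _ <= X]mulr1; apply: ler_wpM2l.
  by apply: mulr_ge0; [exact: ltW|exact: sqr_ge0].
by rewrite ler_pdivrMr // mul1r /m lerDl.
Qed.

End Comparison.

(** * Reflection and barrier on a half cube *)

Section HalfCube.
Variables (R : realType) (N : nat).
Implicit Types (a x y : 'rV[R]_N) (d e h t k : R) (f u : 'rV[R]_N -> R).

(** The mirror image in the hyperplane through a orthogonal to the i-th axis. *)
Definition refl a (i : 'I_N) y : 'rV[R]_N := y + (- (2 * (y 0 i - a 0 i))) *: basis i.

Lemma reflE a i y j :
  refl a i y 0 j = if j == i then 2 * a 0 i - y 0 i else y 0 j.
Proof. by rewrite shiftE; case: eqP => [->|_]; ring. Qed.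

Lemma refl_shift a i y j h :
  refl a i (y + h *: basis j) = refl a i y + (if j == i then - h else h) *: basis j.
Proof.
apply/rowP => l; rewrite [LHS]reflE [RHS]shiftE reflE !shiftE.
have [->|li] := eqVneq l i; have [ji|ji] := eqVneq j i; rewrite ?ji ?eqxx //;
  rewrite ?(negPf li) //.
- by ring.
- by ring.
Qed.

Lemma refl_cube a i d y : cube a d y -> cube a d (refl a i y).
Proof.
move=> yd j; rewrite reflE; case: eqP => [->|_]; last exact: yd.
by rewrite -normrN; have -> : - (2 * a 0 i - y 0 i - a 0 i) = y 0 i - a 0 i by ring.
Qed.

(** The mirror reverses the step in direction i only, and second differences are even in the step.
    Hence the odd part of a weak solution satisfies the same equation. *)
Lemma sdiff_refl u a i y j h :
  sdiff (fun z => u (refl a i z)) y j h = sdiff u (refl a i y) j h.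
Proof.
rewrite /sdiff !refl_shift; case: (j == i) => //.
by rewrite opprK [X in X - _]addrC.
Qed.

Lemma refl_continuous u a i y : {for refl a i y, continuous u} ->
  {for y, continuous (fun z => u (refl a i z))}.
Proof.
move=> /continuous_cubeP C; apply/continuous_cubeP => e /C[d d0 dC].
exists d => // z zd; apply: dC => j; rewrite !reflE; case: eqP => [_|_] //.
by rewrite -normrN; have -> : - (2 * a 0 i - z 0 i - (2 * a 0 i - y 0 i)) = z 0 i - y 0 i by ring.
Qed.

(* Odd reflection and the quadratic barrier of Gilbarg and Trudinger,
   Theorem 3.9, on the half cube y_i >= a_i. *)
Definition barrier a (i : 'I_N) d M F y : R :=
  M / d ^+ 2 * \sum_(j < N) (y 0 j - a 0 j) ^+ 2
  + (N%:R * M / d ^+ 2 + F / 2) * ((y 0 i - a 0 i) * (d - (y 0 i - a 0 i))).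

Lemma barrier_sdiff a i d M F y j h :
  sdiff (barrier a i d M F) y j h = 2 * (M / d ^+ 2) * h ^+ 2
     - (if j == i then 2 * (N%:R * M / d ^+ 2 + F / 2) * h ^+ 2 else 0).
Proof.
rewrite /sdiff /barrier; set A := M / _; set B := _ + F / 2.
have E s : \sum_(l < N) ((y + s *: basis j) 0 l - a 0 l) ^+ 2
    = \sum_(l < N) (y 0 l - a 0 l) ^+ 2 + 2 * s * (y 0 j - a 0 j) + s ^+ 2.
  rewrite (bigD1 j) //= [in RHS](bigD1 j) //= shiftE eqxx.
  rewrite (eq_bigr (fun l => (y 0 l - a 0 l) ^+ 2)); first by ring.
  by move=> l lj; rewrite shiftE (negPf lj) addr0.
rewrite !E !shiftE; move: (\sum_l _) => S.
clearbody A B.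
rewrite eq_sym; case: eqP => [->|_].
  by move: (y 0 i) (a 0 i) => p q; ring.
by ring.
Qed.

(** The coefficient N M / d^2 + F / 2 is chosen for this: the concave term cancels the contribution
    2 N M / d^2 of the paraboloid and leaves exactly -F, for every h. *)
Lemma barrier_sum_sdiff a i d M F y h : 
  \sum_(j < N) sdiff (barrier a i d M F) y j h = - F * h ^+ 2.
Proof.
under eq_bigr do rewrite barrier_sdiff.
rewrite sumrB -big_mkcond /= big_pred1_eq sumr_const card_ord -[X in X - _]mulr_natr -(mulrA N%:R).
by move: (M / d ^+ 2) => A; field.
Qed.

Lemma barrier_continuous a i d M F y : {for y, continuous (barrier a i d M F)}.
Proof.
have C j z0 : {for z0, continuous (fun z : 'rV[R]_N => z 0 j - a 0 j)}.
  by apply: continuousB; [exact: coord_continuous_at|exact: cst_continuous].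
rewrite /barrier; apply: (@continuousD _ _ _ (fun z : 'rV[R]_N => M / d ^+ 2 * \sum_(j < N) (z 0 j - a 0 j) ^+ 2)).
  apply: continuousM; first exact: cst_continuous.
  apply: (@continuous_big _ _ _ _ xpredT _ _ _ (fun j (z : 'rV[R]_N) => (z 0 j - a 0 j) ^+ 2)).
    exact: add_continuous.
  by move=> j _ z; apply: (@continuousM _ _ (fun z : 'rV[R]_N => z 0 j - a 0 j)); exact: C.
apply: continuousM; first exact: cst_continuous.
apply: continuousM; first exact: C.
by apply: continuousB; [exact: cst_continuous|exact: C].
Qed.

End HalfCube.

(** * Gradient estimate by the maximum principle *)

Section GradientEstimate.
Variables (R : realType) (N : nat).
Implicit Types (a x y : 'rV[R]_N) (d e h t k : R) (f u : 'rV[R]_N -> R).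

Definition half_cube a (i : 'I_N) d : set 'rV[R]_N :=
  [set y | cube a d y /\ a 0 i <= y 0 i].

Lemma compact_half_cube a i d : compact (half_cube a i d).
Proof.
have := @rV_compact R N
  (fun j => `[if j == i then a 0 i else a 0 j - d, a 0 j + d]%classic)
  (fun j => @segment_compact R _ _).
have [d0|d0] := leP 0 d; last first.
  move=> _; have -> : half_cube a i d = set0; last exact: compact0.
  by apply/seteqP; split => // y [/(_ i) h _]; have := normr_ge0 (y 0 i - a 0 i); lra.
congr compact; apply/seteqP; split => y /=.
  move=> h; split => [j|]; last by have := h i; rewrite in_itv /= eqxx => /andP[].
  have := h j; rewrite in_itv /= ler_distl => /andP[+ ->]; rewrite andbT.
  by case: eqP => [->|_] //; lra.
move=> [yd yi] j; have := yd j; rewrite in_itv /= ler_distl => /andP[h ->].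
by rewrite andbT; case: eqP => [->|_].
Qed.

Lemma barrier_half_cube a i d M F y : 0 < d -> 0 < M -> 0 < F ->
  half_cube a i d y -> 0 <= barrier a i d M F y.
Proof.
move=> d0 M0 F0 [yd yi]; rewrite /barrier.
have := yd i; rewrite ler_distl => /andP[_ yi'].
apply: addr_ge0; apply: mulr_ge0; try (apply: mulr_ge0; lra).
- by rewrite divr_ge0 ?sqr_ge0 // ltW.
- by apply: sumr_ge0 => j _; exact: sqr_ge0.
- by rewrite addr_ge0 ?divr_ge0 ?mulr_ge0 ?sqr_ge0 // ltW.
Qed.

(** One square equals d^2 there, so the paraboloid alone reaches M, and the other term is
    nonnegative on the half cube. *)
Lemma barrier_side a i d M F y j : 0 < d -> 0 < M -> 0 < F ->
  half_cube a i d y -> `|y 0 j - a 0 j| = d -> M <= barrier a i d M F y.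
Proof.
move=> d0 M0 F0 [yd yi] yj; rewrite /barrier.
have := yd i; rewrite ler_distl => /andP[_ yi'].
rewrite (bigD1 j) //= -[X in X + \sum_(_ | _) _]real_normK ?num_real // yj mulrDr.
rewrite mulfVK ?expf_neq0 ?gt_eqF // -[X in X <= _]addr0 -addrA lerD2l.
apply: addr_ge0; apply: mulr_ge0; try (apply: mulr_ge0; lra).
- by rewrite divr_ge0 ?sqr_ge0 // ltW.
- by apply: sumr_ge0 => l _; exact: sqr_ge0.
- by rewrite addr_ge0 ?divr_ge0 ?mulr_ge0 ?sqr_ge0 // ltW.
Qed.

(** Maximum principle. A positive maximum of the odd part minus the barrier is not on an outer face,
    where the barrier dominates M, nor on the mirror, where the odd part vanishes. At an interior
    point the sum of second differences would be nonpositive, but the equation makes it positive. *)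
Lemma odd_part_le_barrier k (G : set 'rV[R]_N) u a i d M :
  weak_helmholtz k G u -> cube a d `<=` G -> 0 < d -> 0 < M ->
  (forall y, cube a d y -> `|u y| <= M) ->
  forall y, half_cube a i d y ->
    2^-1 * u y - 2^-1 * u (refl a i y) <= barrier a i d M ((k ^+ 2 + 1) * M) y.
Proof.
move=> [uc uh] dG d0 M0 uM.
set F := (k ^+ 2 + 1) * M.
have F0 : 0 < F by apply: mulr_gt0 => //; have := sqr_ge0 k; lra.
pose phi y := 2^-1 * u y + (- 2^-1) * u (refl a i y).
pose w y := phi y + (-1) * barrier a i d M F y.
suff H y : half_cube a i d y -> w y <= 0.
  by move=> y /H; rewrite /w /phi; lra.
have K0 : half_cube a i d !=set0 by exists a; split => //; exact: cube_center (ltW d0).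
have wc : {within half_cube a i d, continuous w}.
  apply: continuous_in_subspaceT => z /set_mem[zd _].
  apply: (@continuousD _ _ _ phi).
    apply: (@continuousD _ _ _ (fun y => 2^-1 * u y)).
      by apply: continuousM; [exact: cst_continuous|apply: uc; exact: dG].
    apply: continuousM; first exact: cst_continuous.
    by apply: refl_continuous; apply: uc; apply: dG; exact: refl_cube.
  by apply: continuousM; [exact: cst_continuous|exact: barrier_continuous].
have [p /set_mem pK pmax] := compact_EVT_max K0 (@compact_half_cube a i d) wc.
move=> yK; apply: le_trans (pmax _ (mem_set yK)) _; rewrite leNgt; apply/negP => wp.
have [pd pi] := pK.
have pB : phi p <= M.
  have := uM _ pd; have := uM _ (refl_cube i pd); rewrite !ler_norml /phi.
  by move=> /andP[? ?] /andP[? ?]; lra.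
have pside j : `|p 0 j - a 0 j| < d.
  rewrite lt_neqAle pd andbT; apply/eqP => /(barrier_side d0 M0 F0 pK) h.
  by move: wp; rewrite /w; lra.
have pi0 : a 0 i < p 0 i.
  rewrite lt_neqAle pi andbT; apply/eqP => E.
  have rp : refl a i p = p.
    by apply/rowP => j; rewrite reflE; case: eqP => [->|//]; rewrite -E; ring.
  have := barrier_half_cube d0 M0 F0 pK; move: wp; rewrite /w /phi rp; lra.
have [r1 r10 R1] : exists2 r, 0 < r & forall j, r <= d - `|p 0 j - a 0 j|.
  apply: (@uniform_radius R _ (fun j r => r <= d - `|p 0 j - a 0 j|)); last by move=> j r r'; exact: le_trans.
  by move=> j; exists (d - `|p 0 j - a 0 j|) => //; rewrite subr_gt0.
(* With F = (k^2 + 1) M, a slack of M h^2 remains after k^2 phi <= k^2 M; the two errors, each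
   weighted by 1/2, use only half of it. *)
have M2 : 0 < M / 2 by rewrite divr_gt0.
have [r2 r20 R2] := uh p (dG _ pd) _ M2.
have [r3 r30 R3] := uh _ (dG _ (refl_cube i pd)) _ M2.
pose r4 := p 0 i - a 0 i.
pose h := Num.min (Num.min r1 r2) (Num.min r3 r4).
have h0 : 0 < h by rewrite !lt_min r10 r20 r30 /r4 subr_gt0.
have : h <= h by [].
rewrite {2}/h !le_min => /andP[/andP[h1 h2] /andP[h3 h4]].
have hK j s : `|s| = h -> half_cube a i d (p + s *: basis j).
  move=> sh; split => [l|]; rewrite shiftE.
    case: eqP => [->|_]; last by rewrite addr0.
    rewrite addrAC; apply: le_trans (ler_normD _ _) _; rewrite sh.
    by have := R1 j; lra.
  have := ler_norm (- s); rewrite normrN sh => s1.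
  by move: h4; rewrite /r4; case: eqP => _; clear -s1 pi0; lra.
have S0 : \sum_(j < N) sdiff w p j h <= 0.
  apply: sumr_le0 => j _.
  have := pmax _ (mem_set (hK j h (gtr0_norm h0))).
  have := pmax _ (mem_set (hK j (- h) _)); rewrite normrN gtr0_norm // => /(_ erefl).
  by rewrite /sdiff; lra.
move: S0.
under eq_bigr do rewrite sdiffD sdiffZ /phi sdiffD !sdiffZ sdiff_refl.
rewrite !big_split /= -!mulr_sumr barrier_sum_sdiff.
have := R2 h; have := R3 h; rewrite gtr0_norm // => /(_ h3) + /(_ h2).
rewrite !ler_norml => /andP[_ B1] /andP[B2 _] S0.
have h20 : 0 < h ^+ 2 by exact: exprn_gt0.
have B3 : 0 <= k ^+ 2 * h ^+ 2 * (M - phi p).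
  by rewrite mulr_ge0 ?subr_ge0 // mulr_ge0 ?sqr_ge0.
have B4 : 0 < M * h ^+ 2 by exact: mulr_gt0.
move: B1 B2 S0 B3; rewrite /F /phi.
move: (\sum_j _) (\sum_j _) (u _) (u _) => Su Sr up ur.
clear -B4; nra.
Qed.

Lemma weak_gradient_estimate_le k (G : set 'rV[R]_N) u a i d M t :
  weak_helmholtz k G u -> cube a d `<=` G -> 0 < d -> 0 < M ->
  (forall y, cube a d y -> `|u y| <= M) -> 0 <= t <= d ->
  u (a + t *: basis i) - u (a + (- t) *: basis i)
    <= 2 * t * ((N%:R / d + (k ^+ 2 + 1) * d / 2) * M).
Proof.
move=> uw dG d0 M0 uM /andP[t0 td].
have K : half_cube a i d (a + t *: basis i).
  split; last by rewrite shiftE eqxx lerDl.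
  by apply: cubeS (cube_shift _ _ _); rewrite ger0_norm.
have := odd_part_le_barrier uw dG d0 M0 uM K.
have -> : refl a i (a + t *: basis i) = a + (- t) *: basis i.
  by apply/rowP => j; rewrite reflE !shiftE eqxx; case: eqP => [->|_]; ring.
rewrite /barrier (bigD1 i) //= big1 => [|j ji].
  rewrite shiftE eqxx addr0 (addrC (a 0 i)) addrK => H.
  have {H} := ler_wpM2l (ler0n R 2) H.
  set L := _ * (_ - _); have -> : L = u (a + t *: basis i) - u (a + (- t) *: basis i).
    by rewrite /L; field.
  move/le_trans; apply.
  (* The linear term in t is the claimed bound; the term in t^2 is subtracted with a nonnegative
     coefficient, since an index i in ['I_N] forces N >= 1. *)
  have E : M / d ^+ 2 * t ^+ 2 + (N%:R * M / d ^+ 2 + (k ^+ 2 + 1) * M / 2) * (t * (d - t))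
    = t * ((N%:R / d + (k ^+ 2 + 1) * d / 2) * M)
      - t ^+ 2 * M * ((N%:R - 1) / d ^+ 2 + (k ^+ 2 + 1) / 2) by field; rewrite gt_eqF.
  rewrite E.
  have N1 : 1 <= N%:R :> R by rewrite ler1n; exact: leq_ltn_trans (leq0n i) (ltn_ord i).
  have : 0 <= t ^+ 2 * M * ((N%:R - 1) / d ^+ 2 + (k ^+ 2 + 1) / 2).
    apply: mulr_ge0; first by rewrite mulr_ge0 ?sqr_ge0 // ltW.
    apply: addr_ge0; apply: divr_ge0 => //; rewrite ?sqr_ge0 ?subr_ge0 //.
    by rewrite addr_ge0 ?sqr_ge0.
  by lra.
by rewrite shiftE (negPf ji) addr0 subrr expr0n.
Qed.

Lemma weak_gradient_estimate k (G : set 'rV[R]_N) u a i d M t :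
  weak_helmholtz k G u -> cube a d `<=` G -> 0 < d -> 0 < M ->
  (forall y, cube a d y -> `|u y| <= M) -> 0 <= t <= d ->
  `|u (a + t *: basis i) - u (a + (- t) *: basis i)|
    <= 2 * t * ((N%:R / d + (k ^+ 2 + 1) * d / 2) * M).
Proof.
move=> uw dG d0 M0 uM td; rewrite ler_norml; apply/andP; split; last first.
  exact: weak_gradient_estimate_le uw dG d0 M0 uM td.
have uw' := weak_helmholtz_lin (-1) 0 uw uw.
have uM' y : cube a d y -> `|-1 * u y + 0 * u y| <= M.
  by move=> /uM; rewrite mul0r addr0 mulN1r normrN.
have := weak_gradient_estimate_le i uw' dG d0 M0 uM' td.
by rewrite !mul0r !addr0 !mulN1r; lra.
Qed.

End GradientEstimate.

(** * Uniform continuity and difference quotients *)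

Section LimitRegularity.
Variables (R : realType) (N : nat).
Implicit Types (a x y : 'rV[R]_N) (d e h t k : R) (f g u w : 'rV[R]_N -> R).

(** Only x is confined to K; y may leave it, as the intermediate points of difference quotients
    do. *)
Lemma uniform_continuity_on_compact (K : set 'rV[R]_N) f : compact K ->
  (forall x, K x -> {for x, continuous f}) ->
  forall e, 0 < e -> exists2 r, 0 < r &
    forall x y, K x -> cube x r y -> `|f y - f x| < e.
Proof.
move=> /compact_near_coveringP Kc fc e e0.
have e2 : 0 < e / 2 by lra.
pose P (r : R) x := forall y, cube x r y -> `|f y - f x| < e.
have H : \forall r \near (0:R)^'+, K `<=` P r.
  apply: Kc => x Kx; have /continuous_cubeP/(_ _ e2)[d d0 dP] := fc x Kx.
  have d2 : 0 < d / 2 by lra.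
  exists (cube x (d / 2), [set r : R | r < d / 2]) => /=.
    by split; [exact: nbhs_cube|exact: nbhs_right_lt].
  move=> [y r] /= [xy rd] z yz.
  have B1 := dP y (cubeS _ xy); have B2 := dP z.
  have -> : f z - f y = (f z - f x) - (f y - f x) by ring.
  apply: le_lt_trans (ler_normB _ _) _.
  have {}B1 : `|f y - f x| < e / 2 by apply: B1; lra.
  have {}B2 : `|f z - f x| < e / 2.
    apply: B2; apply: cubeS (cube_trans xy yz); lra.
  by lra.
have [r [r0 Hr]] : exists r : R, 0 < r /\ K `<=` P r.
  by near (0:R)^'+ => r; exists r; split => //; near: r.
by exists r => // x y /Hr; exact.
Unshelve. all: by end_near.
Qed.

Lemma derivable_epsP f x (v : 'rV[R]_N) L : is_derive x v f L <->
  forall e, 0 < e -> exists2 d, 0 < d & forall t, `|t| <= d ->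
    `|f (x + t *: v) - f x - t * L| <= e * `|t|.
Proof.
split.
  move=> [fd fL] e e0.
  have /cvgrPdist_lt/(_ _ e0) : h^-1 *: (f (h *: v + x) - f x) @[h --> 0^'] --> L.
    by rewrite -fL; exact: fd.
  rewrite near_withinE => /nbhs_ballP[d /= d0 dP].
  exists (d / 2); first by lra.
  move=> t td; have [->|t0] := eqVneq t 0.
    by rewrite scale0r addr0 subrr mul0r subrr normr0 mulr0.
  have {}dP := dP t; have : ball 0 d t by rewrite /ball /= sub0r normrN; lra.
  move=> /dP /(_ t0) /ltW B.
  have -> : f (x + t *: v) - f x - t * L = - ((L - t^-1 * (f (t *: v + x) - f x)) * t).
    by rewrite (addrC x); field.
  by rewrite normrN normrM ler_wpM2r.
move=> H.
have C : h^-1 *: (f (h *: v + x) - f x) @[h --> 0^'] --> L.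
  apply/cvgrPdist_le => e e0; have [d d0 dP] := H e e0.
  rewrite near_withinE; apply/nbhs_ballP; exists d => //= t.
  rewrite /ball /= sub0r normrN => /ltW /dP B t0.
  have -> : L - t^-1 *: (f (t *: v + x) - f x) = - (f (x + t *: v) - f x - t * L) / t.
    by rewrite (addrC x) /GRing.scale /=; field.
  by rewrite normrM normrN normfV ler_pdivrMr // normr_gt0.
by split; [apply/cvg_ex; exists L|exact: cvg_lim C].
Qed.

(** The slope L may change with e: the quotients then form a Cauchy filter, and completeness
    supplies the derivative without naming it. *)
Lemma derivable_of_approx f x (v : 'rV[R]_N) :
  (forall e, 0 < e -> exists L, exists2 d, 0 < d & forall t, `|t| <= d ->
    `|f (x + t *: v) - f x - t * L| <= e * `|t|) -> derivable f x v.
Proof.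
move=> H; apply: cauchy_cvg; apply: cauchy_exP => e e0.
have e2 : 0 < e / 2 by rewrite divr_gt0.
have [L [d d0 dP]] := H _ e2.
exists L.
suff : \forall h \near (0:R)^', ball L e (h^-1 *: (f (h *: v + x) - f x)) by [].
rewrite near_withinE; apply/nbhs_ballP; exists d => //= t.
rewrite /ball /= sub0r normrN => /ltW /dP B t0.
have -> : L - t^-1 *: (f (t *: v + x) - f x) = - (f (x + t *: v) - f x - t * L) / t.
  by rewrite (addrC x) /GRing.scale /=; field.
rewrite normrM normrN normfV.
apply: le_lt_trans (_ : e / 2 < e); last by lra.
by rewrite ler_pdivrMr // normr_gt0.
Qed.

End LimitRegularity.

(** * Uniform limits of weak solutions *)

Section Regularity.
Variables (R : realType) (N : nat).
Implicit Types (a x y : 'rV[R]_N) (d e h t k : R) (f g u w : 'rV[R]_N -> R).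

Definition gradient_constant k d : R := N%:R / d + (k ^+ 2 + 1) * d / 2.

Lemma gradient_constant_ge0 k d : 0 < d -> 0 <= gradient_constant k d.
Proof.
move=> d0; apply: addr_ge0; apply: divr_ge0 => //; try exact: ltW.
by apply: mulr_ge0; [rewrite addr_ge0 ?sqr_ge0|exact: ltW].
Qed.

(** The symmetric estimate is centred at the midpoint of x and x + t e_i. The radii d/2 + d/4 + d/4
    = d keep its cube inside the domain. *)
Lemma weak_lipschitz k u a i d M x t : weak_helmholtz k (cube a d) u ->
  0 < d -> 0 < M -> (forall y, cube a d y -> `|u y| <= M) ->
  cube a (d / 2) x -> `|t| <= d / 2 ->
  `|u (x + t *: basis i) - u x| <= `|t| * (gradient_constant k (d / 4) * M).
Proof.
move=> uw d0 M0 uM xd td.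
pose c := x + (t / 2) *: (basis i : 'rV[R]_N).
have d4 : 0 < d / 4 by lra.
have t2 : `|t / 2| = `|t| / 2 by rewrite normrM normfV (ger0_norm (ler0n R 2)).
have cd : cube c (d / 4) `<=` cube a d.
  move=> y yc; apply: (@cubeS _ _ _ (d / 2 + d / 4 + d / 4)); first by lra.
  apply: cube_trans yc; apply: cube_trans xd _.
  by apply: cubeS (cube_shift _ _ _); rewrite t2; lra.
have tt : 0 <= `|t| / 2 <= d / 4 by have := normr_ge0 t; lra.
have := weak_gradient_estimate i uw cd d4 M0 (fun y yc => uM y (cd y yc)) tt.
rewrite -/(gradient_constant k (d / 4)).
have -> : 2 * (`|t| / 2) = `|t| by field.
suff -> : `|u (c + (`|t| / 2) *: basis i) - u (c + (- (`|t| / 2)) *: basis i)|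
  = `|u (x + t *: basis i) - u x| by [].
have E s : c + s *: basis i = x + (t / 2 + s) *: basis i by rewrite /c -addrA -scalerDl.
rewrite !E; have [t0|/ltW t0] := leP 0 t.
  rewrite (ger0_norm t0) subrr scale0r addr0.
  by have -> : t / 2 + t / 2 = t by field.
rewrite (ler0_norm t0) mulNr opprK subrr scale0r addr0 distrC.
by have -> : t / 2 + t / 2 = t by field.
Qed.

(** The limit g is not yet known to be a weak solution, so w is compared with a second approximant
    w' much closer to g; [weak_lipschitz] applies to w' - w. *)
Lemma limit_lipschitz k g w a i d e x t : weak_helmholtz k (cube a d) w ->
  0 < d -> 0 < e -> 
  (forall e, 0 < e -> exists w, weak_helmholtz k (cube a d) w /\
     forall y, cube a d y -> `|w y - g y| <= e) ->
  (forall y, cube a d y -> `|w y - g y| <= e) ->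
  cube a (d / 2) x -> `|t| <= d / 2 ->
  `|(g (x + t *: basis i) - g x) - (w (x + t *: basis i) - w x)|
     <= `|t| * (gradient_constant k (d / 4) * e).
Proof.
move=> ww d0 e0 appr wg xd td; apply/ler_addgt0Pr => s s0.
set C := gradient_constant _ _.
have d4 : 0 < d / 4 by lra.
have C0 : 0 <= `|t| * C by apply: mulr_ge0 => //; exact: gradient_constant_ge0.
(* Replacing g by w' costs |t| C q in the Lipschitz bound and 2 q at the two endpoints, altogether
   s. *)
pose q : R := s / (`|t| * C + 2).
have q0 : 0 < q by rewrite divr_gt0 //; lra.
have [w' [ww' wg']] := appr q q0.
have eq0 : 0 < e + q by exact: addr_gt0.
have W : forall y, cube a d y -> `|1 * w' y + (-1) * w y| <= e + q.
  move=> y yd; have -> : 1 * w' y + (-1) * w y = (w' y - g y) - (w y - g y) by ring.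
  by apply: le_trans (ler_normB _ _) _; rewrite addrC; apply: lerD; [exact: wg|exact: wg'].
have := weak_lipschitz i (weak_helmholtz_lin 1 (-1) ww' ww) d0 eq0 W xd td.
rewrite -/C; set x' := x + _ => H.
have xd' : cube a d x by apply: cubeS xd; lra.
have x'd : cube a d x'.
  apply: (@cubeS _ _ _ (d / 2 + d / 2)); first by lra.
  by apply: cube_trans xd _; apply: cubeS (cube_shift _ _ _).
have A1 := wg' _ xd'; have A2 := wg' _ x'd.
have -> : g x' - g x - (w x' - w x) =
  (1 * w' x' + -1 * w x' - (1 * w' x + -1 * w x)) + ((w' x - g x) - (w' x' - g x')) by ring.
apply: le_trans (ler_normD _ _) _.
have B : `|(w' x - g x) - (w' x' - g x')| <= q + q.
  by apply: le_trans (ler_normB _ _) _; exact: lerD.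
have E : q * (`|t| * C + 2) = s by rewrite /q; field; lra.
have -> : `|t| * (C * e) + s = `|t| * (C * (e + q)) + (q + q) by rewrite -E; ring.
exact: lerD.
Qed.

(* By the gradient estimate the difference quotients of the approximating
   solutions w converge uniformly too. *)
Lemma limit_C1 k g a d : 0 < d ->
  (forall e, 0 < e -> exists w, [/\ weak_helmholtz k (cube a d) w,
     (forall y, cube a d y -> `|w y - g y| <= e) &
     forall l y, cube a d y -> derivable w y (basis l) /\
       {for y, continuous (partial l w)}]) ->
  forall l, derivable g a (basis l) /\ {for a, continuous (partial l g)}.
Proof.
move=> d0 appr l.
have d4 : 0 < d / 4 by lra.
set C := gradient_constant k (d / 4).
have C0 : 0 <= C by exact: gradient_constant_ge0.
have appr' e : 0 < e -> exists w, weak_helmholtz k (cube a d) w /\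
     forall y, cube a d y -> `|w y - g y| <= e.
  by move=> /appr[w [? ? _]]; exists w.
have der x : cube a (d / 2) x -> derivable g x (basis l).
  move=> xd; apply: derivable_of_approx => e e0.
  pose e' := e / 2 / (C + 1).
  have e'0 : 0 < e' by rewrite divr_gt0 //; lra.
  have e2 : 0 < e / 2 by lra.
  have [w [ww wg wd]] := appr e' e'0.
  have xd' : cube a d x by apply: cubeS xd; lra.
  have [/derivableP/derivable_epsP/(_ _ e2)[r r0 rP] _] := wd l x xd'.
  exists ('D_(basis l) w x); exists (Num.min r (d / 2)).
    by rewrite lt_min r0; lra.
  move=> t; rewrite le_min => /andP[tr td].
  have := limit_lipschitz l ww d0 e'0 appr' wg xd td; rewrite -/C => H.
  have {rP} := rP t tr; set x' := x + _ in H *; set D := 'D_ _ _ _ => H'.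
  have -> : g x' - g x - t * D = (g x' - g x - (w x' - w x)) + (w x' - w x - t * D) by ring.
  apply: le_trans (ler_normD _ _) _.
  have B : C * e' <= e / 2.
    rewrite /e' mulrA ler_pdivrMr; last by lra.
    by rewrite mulrC [X in _ <= X]mulrDr; lra.
  have : `|t| * (C * e') <= `|t| * (e / 2) by rewrite ler_wpM2l.
  by lra.
(* Dividing the Lipschitz bound by a small t bounds the derivative of g - w uniformly on the half
   cube; continuity of the derivative then passes to the limit. *)
have close e w x : 0 < e -> weak_helmholtz k (cube a d) w ->
    (forall y, cube a d y -> `|w y - g y| <= e) ->
    derivable w x (basis l) -> cube a (d / 2) x ->
    `|partial l g x - partial l w x| <= C * e.
  move=> e0 ww wg wd xd; apply/ler_addgt0Pr => s s0.
  have s2 : 0 < s / 2 by lra.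
  have /derivableP/derivable_epsP/(_ _ s2)[r1 r10 r1P] := wd.
  have /derivableP/derivable_epsP/(_ _ s2)[r2 r20 r2P] := der x xd.
  pose t := Num.min (d / 2) (Num.min r1 r2).
  have t0 : 0 < t by rewrite !lt_min r10 r20; lra.
  have : t <= t by []; rewrite {2}/t !le_min => /and3P[td tr1 tr2].
  have nt : `|t| = t by rewrite gtr0_norm.
  have := limit_lipschitz l ww d0 e0 appr' wg xd; move=> /(_ t).
  have := r1P t; have := r2P t; rewrite nt => /(_ tr2) + /(_ tr1) + /(_ td).
  rewrite /partial -/C; set x' := x + _; set D := 'D_ _ _ _; set D' := 'D_ _ _ _.
  move=> H1 H2 H3; rewrite -(ler_pM2l t0) -{1}nt -normrM.
  have -> : t * (D - D') = (g x' - g x - (w x' - w x)) + (w x' - w x - t * D')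
     - (g x' - g x - t * D) by ring.
  apply: le_trans (ler_normB _ _) _.
  have := ler_normD (g x' - g x - (w x' - w x)) (w x' - w x - t * D').
  by rewrite mulrDr; lra.
split; first by apply: der; apply: cube_center; lra.
apply/continuous_cubeP => e e0.
pose e' := e / 3 / (C + 1).
have e'0 : 0 < e' by rewrite divr_gt0 //; lra.
have [w [ww wg wd]] := appr e' e'0.
have e3 : 0 < e / 3 by lra.
have B : C * e' < e / 3.
  by rewrite /e' mulrA ltr_pdivrMr; [rewrite mulrC [X in _ < X]mulrDr; lra|lra].
have ac r : 0 <= r -> cube a r a by exact: cube_center.
have [|wda /continuous_cubeP/(_ _ e3)[r r0 rP]] := wd l a; first by apply: ac; lra.
exists (Num.min r (d / 2)); first by rewrite lt_min r0; lra.
move=> y ym; have yr : cube a r y by apply: cubeS ym; rewrite ge_min lexx.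
have yd : cube a (d / 2) y by apply: cubeS ym; rewrite ge_min lexx orbT.
have [|wdy _] := wd l y; first by apply: cubeS yd; lra.
have H1 := close _ _ _ e'0 ww wg wdy yd.
have H2 := close _ _ _ e'0 ww wg wda (ac (d / 2) _).
have {}H2 : `|partial l g a - partial l w a| <= C * e' by apply: H2; lra.
have {rP} H3 := rP y yr.
move: H1 H2 H3; move: (partial l g y) (partial l g a) (partial l w y) (partial l w a).
move=> p q p' q' H1 H2 H3.
have -> : p - q = (p - p') + (p' - q') - (q - q') by ring.
apply: le_lt_trans (ler_normB _ _) _.
by have := ler_normD (p - p') (p' - q'); lra.
Qed.

End Regularity.

(** * Derivatives of solutions are solutions *)

Section Bootstrap.
Variables (R : realType) (N : nat).
Implicit Types (a x y : 'rV[R]_N) (d e h t k : R) (f g u w : 'rV[R]_N -> R).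

Definition mixed_diff f (i j : 'I_N) h x : R :=
  f (x + h *: basis i + h *: basis j) - f (x + h *: basis i)
  - f (x + h *: basis j) + f x.

Lemma mixed_diff_sym f i j h x : mixed_diff f i j h x = mixed_diff f j i h x.
Proof. by rewrite /mixed_diff (addrAC x); ring. Qed.

(** The mean value theorem in direction i for the increment of f in direction j, followed by the
    mean value theorem in direction j for [partial i f]. *)
Lemma mixed_diff_MVT (G : set 'rV[R]_N) f i j h x :
  class_C 2 G f -> cube x (2 * `|h|) `<=` G ->
  exists2 z, cube x (2 * `|h|) z &
    mixed_diff f i j h x = h ^+ 2 * partial j (partial i f) z.
Proof.
move=> [_ f1] xG.
have cu t s : `|t| <= `|h| -> `|s| <= `|h| ->
    cube x (2 * `|h|) (x + t *: basis i + s *: basis j).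
  move=> th sh; apply: cubeS (cube_trans (cube_shift x t i) (cube_shift _ s j)).
  by lra.
have cu0 t : `|t| <= `|h| -> cube x (2 * `|h|) (x + t *: basis i).
  by move=> th; rewrite -[_ + _]addr0 -(scale0r (basis j)); apply: cu; rewrite ?normr0.
have [t th|c ch E] := @MVT0 R
    (fun t => f (x + h *: basis j + t *: basis i) - f (x + t *: basis i))
    (fun t => partial i f (x + h *: basis j + t *: basis i) - partial i f (x + t *: basis i)) h.
  apply: is_deriveB; apply: is_derive_line; apply: (f1 i).1; apply: xG.
    by rewrite addrAC; exact: cu.
  exact: cu0.
have [t th|c' ch' E'] := @MVT_line R N (partial i f) (x + c *: basis i) h j.
  by apply: ((f1 i).2.2 j).1; apply: xG; exact: cu.
exists (x + c *: basis i + c' *: basis j); first exact: cu.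
have -> : mixed_diff f i j h x =
  (f (x + h *: basis j + h *: basis i) - f (x + h *: basis i)) -
  (f (x + h *: basis j + 0 *: basis i) - f (x + 0 *: basis i)).
  by rewrite /mixed_diff !scale0r !addr0 (addrAC x); ring.
by rewrite E (addrAC x (h *: _)) E'; ring.
Qed.

(** Schwarz's theorem: one symmetric mixed difference equals h^2 times either mixed derivative at
    nearby points, and both are continuous. *)
Lemma partial_comm (G : set 'rV[R]_N) f i j x : open G -> G x -> class_C 2 G f ->
  partial i (partial j f) x = partial j (partial i f) x.
Proof.
move=> Go Gx fC; have [_ f1] := fC.
apply/eqP; rewrite -subr_eq0 -normr_le0; apply/ler_addgt0Pr => e e0; rewrite add0r.
have [d1 d10 dG] := open_cubeP Go Gx.
have e2 : 0 < e / 2 by lra.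
have /continuous_cubeP/(_ _ e2)[d2 d20 H2] := ((f1 i).2.2 j).2.1 x Gx.
have /continuous_cubeP/(_ _ e2)[d3 d30 H3] := ((f1 j).2.2 i).2.1 x Gx.
pose h := Num.min d1 (Num.min d2 d3) / 2.
have h0 : 0 < h by rewrite divr_gt0 // !lt_min d10 d20.
have hE : 2 * h = Num.min d1 (Num.min d2 d3) by rewrite /h; field.
have := lexx (2 * h); rewrite {2}hE !le_min => /and3P[h1 h2 h3].
have nh : `|h| = h by rewrite gtr0_norm.
have [|z1 z1x E1] := @mixed_diff_MVT G f i j h x fC.
  by rewrite nh => y yc; apply: dG; exact: cubeS yc.
have [|z2 z2x E2] := @mixed_diff_MVT G f j i h x fC.
  by rewrite nh => y yc; apply: dG; exact: cubeS yc.
rewrite nh in z1x z2x.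
have B1 := H2 _ (cubeS h2 z1x); have B2 := H3 _ (cubeS h3 z2x).
have E : partial j (partial i f) z1 = partial i (partial j f) z2.
  apply: (mulfI (_ : h ^+ 2 != 0)); first by rewrite expf_neq0 // gt_eqF.
  exact: etrans (esym E1) (etrans (mixed_diff_sym _ _ _ _ _) E2).
rewrite E in B1; apply/ltW; move: B1 B2.
move: (partial i (partial j f) z2) (partial i _ x) (partial j _ x) => p q r; clear => B1 B2.
have -> : q - r = (p - r) - (p - q) by ring.
by apply: le_lt_trans (ler_normB _ _) _; lra.
Qed.

Lemma mixed_diff_weak k (G G' : set 'rV[R]_N) u i j h c :
  weak_helmholtz k G u -> (forall x, G' x -> cube x (2 * `|h|) `<=` G) ->
  weak_helmholtz k G' (fun x => c * mixed_diff u i j h x).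
Proof.
move=> uw GG'.
have S (t s : R) : `|t| <= `|h| -> `|s| <= `|h| ->
    weak_helmholtz k G' (fun x => u (x + (t *: basis i + s *: basis j))).
  move=> th sh; apply: (weak_helmholtz_shift uw) => x /GG'; apply.
  rewrite addrA; apply: cubeS (cube_trans (cube_shift x t i) (cube_shift _ s j)).
  by lra.
have n0 : `|0 : R| <= `|h| by rewrite normr0.
have W := weak_helmholtz_lin c (- c) (S h h (lexx _) (lexx _)) (S h 0 (lexx _) n0).
have W' := weak_helmholtz_lin c (- c) (S 0 0 n0 n0) (S 0 h n0 (lexx _)).
apply: (eq_ind _ (weak_helmholtz k G') (weak_helmholtz_lin 1 1 W W')).
apply/funext => x; rewrite !scale0r !addr0 !add0r /mixed_diff -(addrA x); ring.
Qed.

Lemma near_eq_partial f g i x : (\forall y \near x, f y = g y) ->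
  partial i f x = partial i g x.
Proof. exact: near_eq_derive. Qed.

Lemma is_derive_shift f x y (v : 'rV[R]_N) l :
  is_derive (x + y) v f l -> is_derive x v (fun z => f (z + y)) l.
Proof.
have E : (fun h => h^-1 *: (f (h *: v + (x + y)) - f (x + y)))
  = (fun h => h^-1 *: (f (h *: v + x + y) - f (x + y))).
  by apply/funext => h; rewrite addrA.
by move=> [fd fl]; split; move: fd fl; rewrite /derivable /derive /= E.
Qed.

Lemma partial_shift f y i : partial i (fun z => f (z + y)) = (fun z => partial i f (z + y)).
Proof.
apply/funext => x.
have E : (fun h => h^-1 *: (f (h *: basis i + (x + y)) - f (x + y)))
  = (fun h => h^-1 *: (f (h *: basis i + x + y) - f (x + y))).
  by apply/funext => h; rewrite addrA.
by rewrite /partial /derive /= E.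
Qed.

Lemma continuous_shift f y x : {for x + y, continuous f} ->
  {for x, continuous (fun z : 'rV[R]_N => f (z + y))}.
Proof.
move=> /continuous_cubeP C; apply/continuous_cubeP => e /C[d d0 dP].
exists d => // z zd; apply: dP => j; rewrite !mxE.
by have -> : z 0 j + y 0 j - (x 0 j + y 0 j) = z 0 j - x 0 j by ring.
Qed.

Lemma near_eq_continuous f g x : (\forall y \near x, f y = g y) ->
  {for x, continuous f} -> {for x, continuous g}.
Proof.
move=> /nbhs_cubeP[r r0 rP] /continuous_cubeP C.
apply/continuous_cubeP => e /C[d d0 dP].
exists (Num.min r d); first by rewrite lt_min r0.
move=> y ym; rewrite -(rP y) -?(rP x); first by apply: dP; apply: cubeS ym; rewrite ge_min lexx orbT.
- by apply: cube_center; exact: ltW.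
- by apply: cubeS ym; rewrite ge_min lexx.
Qed.

(** Differentiability is asked near x, because the continuity of the derivative of a linear
    combination is obtained from a formula for it on a neighbourhood. *)
Definition C1_at f x l : Prop :=
  (\forall y \near x, derivable f y (basis l)) /\ {for x, continuous (partial l f)}.

Lemma C1_at_lin f g x l c d : C1_at f x l -> C1_at g x l ->
  C1_at (fun z => c * f z + d * g z) x l.
Proof.
move=> [fd fc] [gd gc].
have D y : derivable f y (basis l) -> derivable g y (basis l) ->
    is_derive y (basis l) (fun z => c * f z + d * g z)
      (c * partial l f y + d * partial l g y).
  move=> /derivableP fy /derivableP gy.
  by apply: is_deriveD; apply: is_deriveZ.
split.
  by apply: filterS2 fd gd => y fy gy; have [] := D y fy gy.
have E : \forall y \near x, c * partial l f y + d * partial l g y =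
    partial l (fun z => c * f z + d * g z) y.
  by apply: filterS2 fd gd => y fy gy; have [_ <-] := D y fy gy.
apply: near_eq_continuous E _.
apply: (@continuousD _ _ _ (fun y => c * partial l f y)).
  by apply: continuousM; [exact: cst_continuous|exact: fc].
by apply: continuousM; [exact: cst_continuous|exact: gc].
Qed.

Lemma mixed_diff_C1 (G : set 'rV[R]_N) f i j h c x l : open G -> class_C 1 G f ->
  cube x (2 * `|h|) `<=` G -> C1_at (fun z => c * mixed_diff f i j h z) x l.
Proof.
move=> Go [_ f1] xG.
have S (t s : R) : `|t| <= `|h| -> `|s| <= `|h| ->
    C1_at (fun z => f (z + (t *: basis i + s *: basis j))) x l.
  move=> th sh; set y := _ + _.
  have Gxy : G (x + y).
    apply: xG; rewrite /y addrA.
    by apply: cubeS (cube_trans (cube_shift x t i) (cube_shift _ s j)); lra.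
  clearbody y; split; last by rewrite partial_shift; apply: continuous_shift; exact: (f1 l).2.1.
  have [d d0 dG] := open_cubeP Go Gxy.
  apply/nbhs_cubeP; exists d => // z zd.
  have Gzy : G (z + y).
    apply: dG => m; rewrite !mxE.
    by have -> : z 0 m + y 0 m - (x 0 m + y 0 m) = z 0 m - x 0 m by ring.
  have /derivableP := (f1 l).1 _ Gzy.
  by move=> /is_derive_shift[].
have n0 : `|0 : R| <= `|h| by rewrite normr0.
have W := C1_at_lin c (- c) (S h h (lexx _) (lexx _)) (S h 0 (lexx _) n0).
have W' := C1_at_lin c (- c) (S 0 0 n0 n0) (S 0 h n0 (lexx _)).
apply: (eq_ind _ (fun f => C1_at f x l) (C1_at_lin 1 1 W W')).
by apply/funext => z; rewrite !scale0r !addr0 !add0r /mixed_diff -(addrA z); ring.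
Qed.

Lemma helmholtz_partial k (G : set 'rV[R]_N) u i : open G ->
  helmholtz_solution G k u -> helmholtz_solution G k (partial i u).
Proof.
move=> Go uh; have [[uc u1] uH] := uh.
have uC2 : class_C 2 G u by case: uh.
have uC1 : class_C 1 G u.
  by split => // j; split; [exact: (u1 j).1|split => //; exact: (u1 j).2.1].
have uw := helmholtz_weak Go uh.
(* The second derivative is the uniform limit of mixed differences divided by h^2, which are weak
   solutions with continuous first derivatives; [limit_C1] provides the missing third
   derivatives. *)
have third a i' j l : G a -> derivable (partial j (partial i' u)) a (basis l) /\
     {for a, continuous (partial l (partial j (partial i' u)))}.
  move=> Ga; have [d d0 dG] := open_cubeP Go Ga.
  have d2 : 0 < d / 2 by lra.
  apply: (@limit_C1 R N k _ a (d / 2)) => // e e0.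
  have [|r r0 rP] := @uniform_continuity_on_compact R N _ (partial j (partial i' u))
     (@compact_cube R N a (d / 2)) _ e e0.
    move=> x xd; apply: ((u1 i').2.2 j).2.1; apply: dG; apply: cubeS xd; lra.
  pose h := Num.min r (d / 2) / 2.
  have h0 : 0 < h by rewrite divr_gt0 // lt_min r0.
  have hE : 2 * h = Num.min r (d / 2) by rewrite /h; field.
  have := lexx (2 * h); rewrite {2}hE !le_min => /andP[h1 h2].
  have nh : `|h| = h by rewrite gtr0_norm.
  have sub x : cube a (d / 2) x -> cube x (2 * `|h|) `<=` G.
    move=> xd y yx; apply: dG; apply: (@cubeS _ _ _ (d / 2 + d / 2)); first by lra.
    by apply: cube_trans xd _; apply: cubeS yx; rewrite nh.
  exists (fun x => (h ^+ 2)^-1 * mixed_diff u i' j h x); split.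
  - exact: mixed_diff_weak uw sub.
  - move=> y yd; have [z zy ->] := mixed_diff_MVT i' j uC2 (sub y yd).
    rewrite mulKf ?expf_neq0 ?gt_eqF //; apply/ltW/rP => //.
    by rewrite nh in zy; exact: cubeS zy.
  - move=> l' y yd.
    have [D C] := mixed_diff_C1 i' j (h ^+ 2)^-1 l' Go uC1 (sub y yd).
    by split=> //; exact: nbhs_singleton D.
have C2 i' : class_C 2 G (partial i' u).
  split; first exact: (u1 i').2.1.
  move=> j; split; first exact: ((u1 i').2.2 j).1.
  split; first exact: ((u1 i').2.2 j).2.1.
  by move=> l; split => [x Gx|]; [|split => // x Gx]; have [] := third x i' j l Gx.
split; first exact: C2.
move=> x Gx.
have nG : nbhs x G by exact: open_nbhs_nbhs.
(* Two exchanges: of j and i on u near x, then of j and i on [partial j u], which is now known to be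
   of class C^2. *)
have E j : partial j (partial j (partial i u)) x = partial i (partial j (partial j u)) x.
  rewrite -(partial_comm _ _ Go Gx (C2 j)); apply: near_eq_partial.
  by apply: filterS nG => y Gy; exact: partial_comm Go Gy uC2.
rewrite /laplacian (eq_bigr _ (fun j _ => E j)).
rewrite /partial -derive_sum; last by move=> j; have [] := third x j j i Gx.
have -> : 'D_(basis i) (\sum_(j < N) partial j (partial j u)) x
   = 'D_(basis i) (fun y => - k ^+ 2 * u y) x.
  apply: near_eq_derive; apply: filterS nG => y /uH; rewrite /laplacian fct_sumE.
  by move=> /eqP; rewrite addr_eq0 mulNr => /eqP.
rewrite deriveZ; last exact: (u1 i).1.
by rewrite /GRing.scale /= mulNr addNr.
Qed.

End Bootstrap.
(** Words, with the outermost derivative first, replace multi-indices: induction on the order then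
    needs no commutation of derivatives. *)
Definition dpart (R : realType) (N : nat) (w : seq 'I_N) (u : 'rV[R]_N -> R) :=
  foldr (@partial R N) u w.

(** * Iterated derivatives and their growth *)

Section Taylor.
Variables (R : realType) (N : nat).
Implicit Types (a x y : 'rV[R]_N) (d e h t k : R) (f g u : 'rV[R]_N -> R).

Lemma helmholtz_dpart k (G : set 'rV[R]_N) u w : open G ->
  helmholtz_solution G k u -> helmholtz_solution G k (dpart w u).
Proof. by move=> Go uh; elim: w => //= i w; exact: helmholtz_partial. Qed.

Lemma helmholtz_gradient_bound k (G : set 'rV[R]_N) u a i d M : open G ->
  helmholtz_solution G k u -> cube a d `<=` G -> 0 < d -> 0 < M ->
  (forall y, cube a d y -> `|u y| <= M) ->
  `|partial i u a| <= gradient_constant N k d * M.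
Proof.
move=> Go uh dG d0 M0 uM; apply/ler_addgt0Pr => e e0.
have Ga : G a by apply: dG; apply: cube_center; exact: ltW.
have /derivableP/derivable_epsP/(_ _ e0)[r r0 rP] := (uh.1.2 i).1 a Ga.
pose t := Num.min d r.
have t0 : 0 < t by rewrite lt_min d0.
have := lexx t; rewrite {2}/t le_min => /andP[td tr].
have td' : 0 <= t <= d by rewrite (ltW t0).
have := weak_gradient_estimate i (helmholtz_weak Go uh) dG d0 M0 uM td'.
rewrite -/(gradient_constant N k d).
have := rP t; have := rP (- t); rewrite normrN gtr0_norm // => /(_ tr) + /(_ tr).
rewrite -/(partial i u a).
move: (u _) (u a) (partial i u a) (gradient_constant _ _ _ * M) (u _) => p q D C s H1 H2 H3.
rewrite -(ler_pM2l t0) -{1}(gtr0_norm t0) -normrM -(ler_pM2l (ltr0n R 2)).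
rewrite -{1}(ger0_norm (ler0n R 2)) -normrM.
have -> : 2 * (t * D) = (p - s) + (s - q - (- t) * D) - (p - q - t * D) by ring.
apply: le_trans (ler_normB _ _) _.
have := ler_normD (p - s) (s - q - (- t) * D).
by rewrite mulrDr mulrDr mulrA; lra.
Qed.

Definition growth_constant k : R := N%:R + k ^+ 2 + 1.

Lemma growth_constant_ge1 k : 1 <= growth_constant k.
Proof. by rewrite /growth_constant lerDr addr_ge0 ?sqr_ge0. Qed.

Lemma gradient_constant_le k d : 0 < d <= 1 ->
  gradient_constant N k d <= growth_constant k / d.
Proof.
move=> /andP[d0 d1]; rewrite /gradient_constant /growth_constant -(addrA N%:R) [X in _ <= X]mulrDl lerD2l.
have q0 : 0 <= k ^+ 2 + 1 by rewrite addr_ge0 ?sqr_ge0.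
rewrite ler_pdivlMr //; have -> : (k ^+ 2 + 1) * d / 2 * d = (k ^+ 2 + 1) * (d ^+ 2 / 2) by ring.
apply: ler_piMr => //; have := exprn_ile1 2 (ltW d0) d1; lra.
Qed.

(** Each derivative consumes a layer of width d, so a word of length m needs a cube of radius m d.
    Taking d = rho / m later gives the growth (C m)^m. *)
Lemma dpart_bound k (G : set 'rV[R]_N) u w a d M : open G ->
  helmholtz_solution G k u -> 0 < d <= 1 -> 0 < M ->
  cube a ((size w)%:R * d) `<=` G ->
  (forall y, cube a ((size w)%:R * d) y -> `|u y| <= M) ->
  `|dpart w u a| <= (growth_constant k / d) ^+ size w * M.
Proof.
move=> Go uh dd M0; have /andP[d0 d1] := dd.
have g1 := growth_constant_ge1 k.
elim: w a => [|i w IH] a /= aG uM.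
  by rewrite expr0 mul1r; apply: uM; apply: cube_center; rewrite mul0r.
have C0 : 0 < growth_constant k / d by rewrite divr_gt0 //; lra.
have sub b : cube a d b -> cube b ((size w)%:R * d) `<=` cube a ((size w).+1%:R * d).
  move=> ab y yb; apply: cubeS (cube_trans ab yb).
  by rewrite -natr1 mulrDl mul1r; lra.
have H := @helmholtz_gradient_bound k G (dpart w u) a i d ((growth_constant k / d) ^+ size w * M).
apply: le_trans (H Go _ _ d0 _ _) _.
- exact: helmholtz_dpart.
- move=> y yd; apply: aG; apply: cubeS yd.
  by rewrite -natr1 mulrDl mul1r lerDr mulr_ge0 // ltW.
- by rewrite mulr_gt0 // exprn_gt0.
- move=> y yd; apply: IH => z zy; [apply: aG|apply: uM]; exact: sub zy.
rewrite exprS -mulrA ler_wpM2r ?gradient_constant_le //.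
by rewrite mulr_ge0 ?exprn_ge0 // ltW.
Qed.

(** Induction over the list of directions: the move along the last coordinate is controlled by the
    mean value theorem, based at the point reached by the other moves. *)
Lemma is_derive_dir f x y (r : seq 'I_N) :
  (forall i, \forall z \near x, derivable f z (basis i)) ->
  (forall i, {for x, continuous (partial i f)}) ->
  is_derive x (\sum_(i <- r) y 0 i *: basis i) f
    (\sum_(i <- r) y 0 i * partial i f x).
Proof.
move=> fd fc; elim: r => [|i r IH]; first by rewrite !big_nil; exact: is_derive0.
rewrite !big_cons; apply/derivable_epsP => e e0.
have e2 : 0 < e / 2 by lra.
have [d1 d10 H1] := (derivable_epsP _ _ _ _).1 IH _ e2.
set z := \sum_(i <- r) _ *: _ in IH H1 *; set D := \sum_(i <- r) _ in IH H1 *.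
have c0 : 0 < e / 2 / (`|y 0 i| + 1) by rewrite divr_gt0 // ltr_wpDl.
have [d2 d20 H2] := (continuous_cubeP _ _).1 (fc i) _ c0.
have /nbhs_cubeP[d3 d30 H3] := fd i.
pose m := Num.min d2 d3.
have m0 : 0 < m by rewrite lt_min d20.
(* An upper bound for the displacement per unit of t, so that |t| b <= m keeps all intermediate
   points in the cube of radius m. *)
pose b : R := \sum_(j < N) `|z 0 j| + `|y 0 i| + 1.
have b1 : 0 <= \sum_(j < N) `|z 0 j| by exact: sumr_ge0.
have b0 : 0 < b by have := normr_ge0 (y 0 i); rewrite /b; lra.
exists (Num.min d1 (m / b)); first by rewrite lt_min d10 divr_gt0.
move=> t; rewrite le_min => /andP[t1]; rewrite ler_pdivlMr // => tb.
have cz c : `|c| <= `|t * y 0 i| -> cube x m (x + t *: z + c *: basis i).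
  move=> ct.
  have xz : cube x (`|t| * \sum_(j < N) `|z 0 j|) (x + t *: z).
    move=> j; have -> : (x + t *: z) 0 j - x 0 j = t * z 0 j by rewrite 2!mxE; ring.
    rewrite normrM ler_wpM2l //.
    by rewrite (bigD1 j) //= lerDl sumr_ge0.
  apply: cubeS (cube_trans xz (cube_shift _ c i)).
  by move: tb ct; rewrite /b normrM !mulrDr mulr1; have := normr_ge0 t; lra.
have [s sh|c ch E] := @MVT_line R N f (x + t *: z) (t * y 0 i) i.
  by apply: H3; apply: cubeS (cz s sh); rewrite ge_min lexx orbT.
rewrite scalerDr scalerA (addrC (_ *: basis i)) addrA.
have {}H1 := H1 t t1.
have {}H2 : `|partial i f (x + t *: z + c *: basis i) - partial i f x| < e / 2 / (`|y 0 i| + 1).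
  by apply: H2; apply: cubeS (cz c ch); rewrite ge_min lexx.
have -> : f (x + t *: z + (t * y 0 i) *: basis i) - f x - t * (y 0 i * partial i f x + D)
  = (f (x + t *: z + (t * y 0 i) *: basis i) - f (x + t *: z) - t * y 0 i * partial i f x)
    + (f (x + t *: z) - f x - t * D) by ring.
rewrite E -mulrBr; apply: le_trans (ler_normD _ _) _.
have : `|t * y 0 i * (partial i f (x + t *: z + c *: basis i) - partial i f x)| <= e / 2 * `|t|.
  rewrite !normrM -mulrA [X in _ <= X]mulrC; apply: ler_wpM2l => //.
  move/ltW: H2; rewrite (ler_pdivlMr _ _ (_ : 0 < `|y 0 i| + 1)); last by rewrite ltr_wpDl.
  set q := `|_ - _|; have q0 : 0 <= q by exact: normr_ge0.
  by rewrite mulrDr mulr1 (mulrC q); lra.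
by lra.
Qed.

Lemma is_derive_along (G : set 'rV[R]_N) f a y t : open G -> class_C 1 G f ->
  G (a + t *: y) -> is_derive t 1 (fun s => f (a + s *: y))
    (\sum_(i < N) y 0 i * partial i f (a + t *: y)).
Proof.
move=> Go [_ f1] Gx.
have H := @is_derive_dir f (a + t *: y) y (index_enum 'I_N) _ (fun i => (f1 i).2.1 _ Gx).
have {H} : is_derive (a + t *: y) y f (\sum_(i < N) y 0 i * partial i f (a + t *: y)).
  rewrite {2}[y]row_sum_delta; apply: H => i.
  by apply: filterS (open_nbhs_nbhs (conj Go Gx)) => z; exact: (f1 i).1.
have E : (fun h => h^-1 *: (f (h *: y + (a + t *: y)) - f (a + t *: y)))
  = (fun h => h^-1 *: (f (a + (h *: 1 + t) *: y) - f (a + t *: y))).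
  apply/funext => h; congr (_ *: (f _ - _)).
  by rewrite [h *: 1]mulr1 scalerDl addrCA.
by move=> [fd fl]; split; move: fd fl; rewrite /derivable /derive /= E.
Qed.

End Taylor.
Fixpoint words (N : nat) (m : nat) : seq (seq 'I_N) :=
  if m is m'.+1 then [seq i :: w | i <- index_enum 'I_N, w <- words N m']
  else [:: [::]].

(** * Directional Taylor expansion over words *)

Section Words.
Variables (R : realType) (N : nat).
Implicit Types (a x y : 'rV[R]_N) (d e h t k : R) (f g u : 'rV[R]_N -> R).

Definition word_monomial (w : seq 'I_N) y : R := \prod_(i <- w) y 0 i.

(** For a solution u, the m-th derivative of u at x along y. Summing over ordered words makes
    multinomial coefficients disappear. *)
Definition jet m y u x : R :=
  \sum_(w <- words N m) word_monomial w y * dpart w u x.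

Lemma mem_words m w : (w \in words N m) = (size w == m).
Proof.
elim: m w => [|m IH] w; first by rewrite inE; case: w.
apply/allpairsP/idP => [[[i v] [_ /=]]|].
  by rewrite IH => /eqP vm ->; rewrite /= vm.
case: w => // i w /= wm; exists (i, w); split => //=; first exact: mem_index_enum.
by rewrite IH.
Qed.

Lemma size_words m : size (words N m) = (N ^ m)%N.
Proof.
elim: m => //= m IH; rewrite size_allpairs IH expnS; congr (_ * _)%N.
by rewrite -[RHS]card_ord cardT enumT -enumT /index_enum -enumT.
Qed.

Lemma jetS m y u x :
  jet m.+1 y u x = \sum_(w <- words N m) word_monomial w y *
     \sum_(i < N) y 0 i * partial i (dpart w u) x.
Proof.
rewrite /jet /= big_allpairs_dep exchange_big; apply: eq_bigr => w _.
rewrite mulr_sumr; apply: eq_bigr => i _.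
by rewrite /word_monomial big_cons /=; ring.
Qed.

Lemma is_derive_big_seq (I : Type) (r : seq I) (h : I -> R -> R) (dh : I -> R) (t : R) :
  (forall i, is_derive t 1 (h i) (dh i)) ->
  is_derive t 1 (fun s => \sum_(i <- r) h i s) (\sum_(i <- r) dh i).
Proof.
move=> hd; elim: r => [|i r IH].
  rewrite big_nil; under eq_fun do rewrite big_nil; exact: is_derive_cst.
rewrite big_cons; under eq_fun do rewrite big_cons; exact: is_deriveD.
Qed.

Lemma is_derive_jet k (G : set 'rV[R]_N) u a y m t : open G ->
  helmholtz_solution G k u -> G (a + t *: y) ->
  is_derive t 1 (fun s => jet m y u (a + s *: y)) (jet m.+1 y u (a + t *: y)).
Proof.
move=> Go uh Gx; rewrite jetS; apply: is_derive_big_seq => w.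
have [[c f1] _] := helmholtz_dpart w Go uh.
have C1 : class_C 1 G (dpart w u).
  by split => // j; split; [exact: (f1 j).1|split => //; exact: (f1 j).2.1].
have D := is_derive_along Go C1 Gx.
by apply: is_deriveZ.
Qed.

(** A substitute for Stirling: m^m <= (2m)(2m - 1)...(m + 1) = C(2m, m) m!, and a binomial
    coefficient of 2m is at most 2^(2m). *)
Lemma expn_self_le m : (m ^ m <= 4 ^ m * m`!)%N.
Proof.
apply: (@leq_trans ((m + m) ^_ m)).
  rewrite ffact_prod; have -> : (m ^ m = \prod_(i < m) m)%N by rewrite prod_nat_const card_ord.
  by apply: leq_prod => i _; rewrite -addnBA ?leq_addr // ltnW.
rewrite -bin_ffact leq_mul2r; apply/orP; right.
have -> : (4 ^ m = 2 ^ (m + m))%N by rewrite addnn -mul2n expnM.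
have -> : (2 ^ (m + m) = \sum_(i < (m + m).+1) 'C(m + m, i))%N.
  by rewrite -[2%N]/(1 + 1)%N expnDn; apply: eq_bigr => i _; rewrite !exp1n !muln1.
have hm : (m < (m + m).+1)%N by rewrite ltnS leq_addr.
by rewrite (bigD1 (Ordinal hm)) //= leq_addr.
Qed.

(** The derivative of the remainder is the remainder of the shifted sequence F 1, F 2, ..., to which
    the induction applies; a monotonicity comparison takes the place of integration. *)
Lemma taylor_bound (F : nat -> R -> R) n (B : R) :
  (forall m (t : R), 0 <= t <= 1 -> is_derive t 1 (F m) (F m.+1 t)) ->
  (forall t, 0 <= t <= 1 -> `|F n t| <= B) ->
  forall t, 0 <= t <= 1 ->
  `|F 0%N t - \sum_(m < n) F m 0 * (t ^+ m / m`!%:R)| <= B * (t ^+ n / n`!%:R).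
Proof.
have powd m (c t : R) : is_derive t 1 (fun s => c * (s ^+ m.+1 / m.+1`!%:R)) (c * (t ^+ m / m`!%:R)).
  have X : is_derive t 1 (fun s : R => s ^+ m.+1) (m.+1%:R * t ^+ m).
    have -> : (fun s : R => s ^+ m.+1) = (@id R : R -> R) ^+ m.+1.
      by apply/funext => s; rewrite exprfctE.
    apply: (is_derive_eq (is_deriveX m.+1 (is_derive_id t 1))).
    by rewrite /GRing.scale /= mulr1.
  have -> : (fun s => c * (s ^+ m.+1 / m.+1`!%:R)) = (fun s => c / m.+1`!%:R * s ^+ m.+1).
    by apply/funext => s; ring.
  apply: (is_derive_eq (is_deriveZ (c / m.+1`!%:R) X)); rewrite /GRing.scale /=.
  rewrite factS natrM; field.
  by rewrite pnatr_eq0 -lt0n fact_gt0 /= addrC natr1 pnatr_eq0.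
elim: n F => [|n IH] F Fd FB t t01.
  rewrite big_ord0 subr0 expr0 fact0 divr1 mulr1; exact: FB.
pose P s := F 0%N s - \sum_(m < n.+1) F m 0 * (s ^+ m / m`!%:R).
pose dP s := F 1%N s - \sum_(m < n) F m.+1 0 * (s ^+ m / m`!%:R).
have Pd (s : R) : 0 <= s <= 1 -> is_derive s 1 P (dP s).
  move=> s01; rewrite /P.
  have -> : (fun s : R => F 0%N s - \sum_(m < n.+1) F m 0 * (s ^+ m / m`!%:R))
    = (fun s : R => F 0%N s - (F 0%N 0 + \sum_(m < n) F m.+1 0 * (s ^+ m.+1 / m.+1`!%:R))).
    by apply/funext => r; rewrite big_ord_recl expr0 fact0 divr1 mulr1.
  apply: is_deriveB; first exact: Fd.
  rewrite -[X in is_derive _ _ _ X]add0r.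
  apply: (@is_deriveD _ _ _ (fun=> F 0%N 0)).
  by apply: is_derive_big_seq => i; exact: powd.
have P0 : P 0 = 0.
  rewrite /P big_ord_recl expr0 fact0 divr1 mulr1 big1 ?addr0 ?subrr // => i _.
  by rewrite expr0n /= mul0r mulr0.
have dPB (s : R) : 0 <= s <= 1 -> `|dP s| <= B * (s ^+ n / n`!%:R).
  by move=> s01; apply: (IH (fun m => F m.+1)) => // m s'; exact: Fd.
rewrite -/(P t).
have [/andP[t0 t1] [t00|tp]] := (t01, eqVneq t 0).
  rewrite t00 P0 normr0 expr0n /= mul0r mulr0 //.
have {}tp : 0 < t by rewrite lt_def tp.
(* Used with c = 1 and c = -1: the difference Q vanishes at 0 and has a nonnegative derivative. *)
have sg (c : R) : `|c| = 1 -> c * P t <= B * (t ^+ n.+1 / n.+1`!%:R).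
  move=> c1; pose Q s := B * (s ^+ n.+1 / n.+1`!%:R) - c * P s.
  have Qd (s : R) : 0 <= s <= 1 -> is_derive s 1 Q (B * (s ^+ n / n`!%:R) - c * dP s).
    move=> /Pd ?; exact: is_deriveB.
  have sub (s : R) : s \in `[0, t] -> 0 <= s <= 1.
    by rewrite in_itv /= => /andP[-> st]; exact: le_trans st t1.
  have D s : s \in `]0, t[ -> is_derive s 1 Q (B * (s ^+ n / n`!%:R) - c * dP s).
    by move/subset_itv_oo_cc/sub; exact: Qd.
  have W : {within `[0, t], continuous Q}.
    by apply: derivable_within_continuous => s /sub /Qd [].
  have [s] := MVT tp D W.
  move=> /subset_itv_oo_cc/sub s01 E.
  have : 0 <= Q t - Q 0.
    rewrite E mulr_ge0 // ?subr0 // subr_ge0.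
    by apply: le_trans (ler_norm _) _; rewrite normrM c1 mul1r dPB.
  by rewrite /Q P0 expr0n /= mul0r !mulr0 !subr0 subr_ge0.
rewrite ler_norml; apply/andP; split.
  by have := sg (-1); rewrite normrN normr1 => /(_ erefl); lra.
by have := sg 1; rewrite normr1 => /(_ erefl); lra.
Qed.

End Words.

(** * Power series expansion of solutions *)

Section Analyticity.
Variables (R : realType) (N : nat).
Implicit Types (a x y : 'rV[R]_N) (d e h t k : R) (f g u : 'rV[R]_N -> R).

Lemma local_bound (G : set 'rV[R]_N) f a : open G -> G a -> {for a, continuous f} ->
  exists d M, [/\ 0 < d <= 1, 0 < M, cube a d `<=` G &
    forall y, cube a d y -> `|f y| <= M].
Proof.
move=> Go Ga /continuous_cubeP/(_ 1 ltr01)[d1 d10 H].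
have [d2 d20 dG] := open_cubeP Go Ga.
pose d := Num.min 1 (Num.min d1 d2).
have d0 : 0 < d by rewrite !lt_min ltr01 d10.
have := lexx d; rewrite {2}/d !le_min => /and3P[h1 h2 h3].
exists d, (`|f a| + 1); split.
- by rewrite d0.
- by rewrite ltr_wpDl.
- by move=> y yd; apply: dG; exact: cubeS yd.
- move=> y /(cubeS h2) /H h; have -> : f y = f a + (f y - f a) by ring.
  by apply: le_trans (ler_normD _ _) _; rewrite lerD2l ltW.
Qed.

Lemma word_monomial_bound (w : seq 'I_N) y (r : R) :
  (forall i, `|y 0 i| <= r) -> `|word_monomial w y| <= r ^+ size w.
Proof.
move=> yr; rewrite /word_monomial; elim: w => [|i w IH].
  by rewrite big_nil normr1.
by rewrite big_cons normrM exprS ler_pM.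
Qed.

(** Origin of 16 K^2: there are N^m words, each with a derivative at most (2 K m / d)^m M and a
    monomial at most r^m. With r = d / (16 K^2) and N <= K the product is at most (m / 8)^m M, and
    m^m <= 4^m m! leaves m! M / 2^m. Absolute values stand inside the sum so that partial sums over
    words are bounded too. *)
Lemma jet_norm_bound k (G : set 'rV[R]_N) u a d M x y m : open G ->
  helmholtz_solution G k u -> 0 < d <= 1 -> 0 < M -> cube a d `<=` G ->
  (forall y, cube a d y -> `|u y| <= M) ->
  cube a (d / 2) x ->
  (forall i, `|y 0 i| <= d / (16 * growth_constant N k ^+ 2)) ->
  \sum_(w <- words N m) `|word_monomial w y * dpart w u x|
    <= m`!%:R * (2^-1 ^+ m * M).
Proof.
move=> Go uh /andP[d0 d1] M0 aG uM xa yr.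
set K := growth_constant N k in yr *.
have K1 : 1 <= K by exact: growth_constant_ge1.
have KN : N%:R <= K by rewrite /K /growth_constant -addrA lerDl addr_ge0 ?sqr_ge0.
set r := d / _ in yr.
have r0 : 0 <= r by rewrite divr_ge0 ?(ltW d0) // mulr_ge0 ?sqr_ge0.
have D w : w \in words N m -> `|dpart w u x| <= (K * m%:R / (d / 2)) ^+ m * M.
  rewrite mem_words => /eqP wm.
  (* For m > 0 the room d/2 around x is cut into m layers; for m = 0 there is no such width and the
     bound on u is used directly. *)
  have [m0|m0] := posnP m.
    rewrite m0 in wm *; rewrite (size0nil wm) expr0 mul1r /=.
    by apply: uM; apply: cubeS xa; lra.
  have mR : 0 < m%:R :> R by rewrite ltr0n.
  have mE : m%:R * (d / 2 / m%:R) = d / 2 by field; rewrite gt_eqF.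
  have sub y' : cube x (d / 2) y' -> cube a d y'.
    by move=> yx; apply: (@cubeS _ _ _ (d / 2 + d / 2)) (cube_trans xa yx); lra.
  have H := @dpart_bound R N k G u w x (d / 2 / m%:R) M Go uh.
  rewrite wm mE in H.
  have -> : K * m%:R / (d / 2) = K / (d / 2 / m%:R) by field; rewrite !gt_eqF.
  apply: H => //; last 2 first.
  - by move=> y' /sub; exact: aG.
  - by move=> y' /sub; exact: uM.
  rewrite divr_gt0 /= ?divr_gt0 // ler_pdivrMr // mul1r.
  have : 1 <= m%:R :> R by rewrite ler1n.
  by lra.
apply: le_trans (_ : \sum_(w <- words N m) (r ^+ m * ((K * m%:R / (d / 2)) ^+ m * M)) <= _).
  rewrite big_seq [X in _ <= X]big_seq; apply: ler_sum => w wm.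
  rewrite normrM ler_pM ?D //; move: wm; rewrite mem_words => /eqP <-.
  exact: word_monomial_bound.
rewrite big_const_seq count_predT size_words iter_addr_0 -[X in X <= _]mulr_natl natrX.
have -> : N%:R ^+ m * (r ^+ m * ((K * m%:R / (d / 2)) ^+ m * M))
   = (N%:R / K / 8) ^+ m * (m%:R ^+ m * M).
  rewrite !mulrA -!exprMn; congr (_ ^+ m * _).
  by rewrite /r; field; rewrite !gt_eqF //; lra.
have F : m%:R ^+ m <= 4 ^+ m * m`!%:R :> R.
  by rewrite -!natrX -natrM ler_nat expn_self_le.
have NK : 0 <= N%:R / K / 8 <= 8^-1.
  rewrite divr_ge0 ?divr_ge0 /=; try lra.
    by rewrite -[X in _ <= X]mul1r ler_wpM2r // ler_pdivrMr ?mul1r; lra.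
  by [].
have /andP[NK0 NK1] := NK.
apply: le_trans (_ : (8^-1) ^+ m * (4 ^+ m * m`!%:R * M) <= _).
  apply: ler_pM.
  - exact: exprn_ge0.
  - by rewrite mulr_ge0 ?exprn_ge0 // ltW.
  - by apply: lerXn2r; rewrite ?nnegrE //; lra.
  - by rewrite ler_wpM2r // ltW.
rewrite !mulrA -exprMn; have -> : 8^-1 * 4 = 2^-1 :> R by field.
by rewrite [X in X * M]mulrC -!mulrA.
Qed.

Lemma helmholtz_taylor k (G : set 'rV[R]_N) u a d M y n : open G ->
  helmholtz_solution G k u -> 0 < d <= 1 -> 0 < M -> cube a d `<=` G ->
  (forall y, cube a d y -> `|u y| <= M) ->
  (forall i, `|y 0 i| <= d / (16 * growth_constant N k ^+ 2)) ->
  `|u (a + y) - \sum_(m < n) jet m y u a / m`!%:R| <= 2^-1 ^+ n * M.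
Proof.
move=> Go uh dd M0 aG uM yr; have /andP[d0 d1] := dd.
have K1 := growth_constant_ge1 N k.
have yd t : 0 <= t <= 1 -> cube a (d / 2) (a + t *: y).
  move=> /andP[t0 t1] j; have -> : (a + t *: y) 0 j - a 0 j = t * y 0 j by rewrite 2!mxE; ring.
  rewrite normrM ger0_norm //.
  apply: (@le_trans _ _ (1 * (d / 2))); last by rewrite mul1r.
  apply: ler_pM => //; apply: le_trans (yr j) _.
  apply: ler_wpM2l; first exact: ltW.
  rewrite lef_pV2 ?posrE // ?mulr_gt0 ?exprn_gt0 //; try lra.
  by have := exprn_ege1 2 K1; lra.
have fpos : 0 < n`!%:R :> R by rewrite ltr0n fact_gt0.
have := @taylor_bound R (fun m t => jet m y u (a + t *: y)) n (n`!%:R * (2^-1 ^+ n * M)).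
move=> /(_ _ _ 1) H.
have {H} : `|jet 0 y u (a + 1 *: y) - \sum_(m < n) jet m y u (a + 0 *: y) * (1 ^+ m / m`!%:R)|
    <= n`!%:R * (2^-1 ^+ n * M) * (1 ^+ n / n`!%:R).
  apply: H; last by rewrite ler01 lexx.
    move=> m t t01; apply: is_derive_jet Go uh _; apply: aG.
    by apply: cubeS (yd t t01); lra.
  move=> t t01; apply: le_trans (ler_norm_sum _ _ _) _.
  exact: jet_norm_bound Go uh dd M0 aG uM (yd t t01) yr.
rewrite {1}/jet /= big_seq1 /word_monomial big_nil mul1r scale1r scale0r addr0 /=.
rewrite expr1n mul1r mulrAC divff ?gt_eqF // mul1r.
by under eq_bigr do rewrite expr1n mul1r.
Qed.

Lemma half_power_small e : 0 < e -> exists n, (2^-1 : R) ^+ n < e.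
Proof.
move=> e0; have h : `|2^-1 : R| < 1 by rewrite ger0_norm; lra.
have /cvgrPdist_lt/(_ _ e0)[n _ /(_ n (leqnn n)) /=] := cvg_expr h.
by rewrite sub0r normrN ger0_norm ?exprn_ge0 //; exists n.
Qed.

Lemma geometric_tail n L : (n <= L)%N ->
  \sum_(n <= m < L) (2^-1 : R) ^+ m <= 2 * 2^-1 ^+ n.
Proof.
move=> nL; suff : \sum_(n <= m < L) (2^-1 : R) ^+ m <= 2 * 2^-1 ^+ n - 2 * 2^-1 ^+ L.
  have : 0 <= (2^-1 : R) ^+ L by rewrite exprn_ge0.
  by lra.
elim: L nL => [|L IH]; first by rewrite leqn0 => /eqP ->; rewrite big_geq // subrr.
rewrite leq_eqVlt => /orP[/eqP ->|]; first by rewrite big_geq // subrr.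
by rewrite ltnS => nL; rewrite big_nat_recr //= exprS; have := IH nL; lra.
Qed.

Definition word_type (w : seq 'I_N) : {ffun 'I_N -> nat} := [ffun i => count_mem i w].

Lemma word_type_cons i w : word_type (i :: w) =
  [ffun j => ((i == j) + word_type w j)%N].
Proof. by apply/ffunP => j; rewrite !ffunE. Qed.

Lemma monomial_word_type w y : monomial (word_type w) y = word_monomial w y.
Proof.
rewrite /monomial /word_monomial; elim: w => [|i w IH].
  by rewrite big_nil big1 // => i _; rewrite ffunE /= expr0.
rewrite big_cons -IH word_type_cons; under eq_bigr do rewrite ffunE exprD.
rewrite big_split /=; congr (_ * _); rewrite (bigD1 i) //= eqxx expr1 big1 ?mulr1 //.
by move=> j ji; rewrite eq_sym (negPf ji) expr0.
Qed.

Definition degree (alpha : {ffun 'I_N -> nat}) : nat := \sum_(i < N) alpha i.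

Lemma degree_word_type w : degree (word_type w) = size w.
Proof.
rewrite /degree; elim: w => [|i w IH].
  by rewrite big1 // => i _; rewrite ffunE.
rewrite word_type_cons /=; under eq_bigr do rewrite ffunE.
rewrite big_split /= IH (bigD1 i) //= eqxx big1 // => j ji.
by rewrite eq_sym (negPf ji).
Qed.

(** For smooth u this is the usual coefficient, the derivative of index alpha over alpha!: the words
    of type alpha number |alpha|! / alpha!. Summing over words makes this count unnecessary. *)
Definition taylor_coef u a (alpha : {ffun 'I_N -> nat}) : R :=
  (\sum_(w <- words N (degree alpha) | word_type w == alpha) dpart w u a)
    / (degree alpha)`!%:R.

(** A word contributes only to the multi-index that is its type, so a finite partial sum can be
    regrouped by degree. *)
Lemma sum_taylor_terms u a y (A : {fset {ffun 'I_N -> nat}}) L :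
  (forall alpha, alpha \in A -> (degree alpha < L)%N) ->
  \sum_(alpha <- A) taylor_coef u a alpha * monomial alpha y =
  \sum_(0 <= m < L) (\sum_(w <- words N m | word_type w \in A)
     word_monomial w y * dpart w u a) / m`!%:R.
Proof.
move=> AL.
pose T w := word_monomial w y * dpart w u a.
transitivity (\sum_(alpha <- A) \sum_(0 <= m < L) \sum_(w <- words N m)
    (if word_type w == alpha then T w / m`!%:R else 0)).
  rewrite big_seq [RHS]big_seq; apply: eq_bigr => alpha /AL aL.
  rewrite big_mkord (bigD1 (Ordinal aL)) //= [X in _ + X]big1 => [|m ma].
    rewrite addr0 -big_mkcond /= /taylor_coef mulrAC mulr_suml mulr_suml.
    apply: eq_bigr => w /eqP wa; rewrite /T -monomial_word_type wa.
    by rewrite [dpart _ _ _ * _]mulrC.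
  rewrite big_seq big1 // => w; rewrite mem_words => /eqP wm.
  case: eqP => // wa; move: ma; rewrite -val_eqE /= -wa degree_word_type wm.
  by rewrite eqxx.
rewrite exchange_big /=; apply: eq_bigr => m _; rewrite exchange_big /=.
rewrite mulr_suml [RHS]big_mkcond /=; apply: eq_bigr => w _.
case: ifP => wA; last first.
  by rewrite big_seq big1 // => alpha aA; case: eqP => // E; rewrite E aA in wA.
rewrite (big_rem (word_type w)) //= eqxx big_seq big1 ?addr0 // => alpha.
rewrite mem_rem_uniq ?fset_uniq // inE => /andP[na _].
by rewrite eq_sym (negPf na).
Qed.

Lemma helmholtz_analytic k (G : set 'rV[R]_N) u : open G ->
  helmholtz_solution G k u -> analytic_on G u.
Proof.
move=> Go uh a Ga; exists (taylor_coef u a).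
have [d [M [dd M0 aG uM]]] := local_bound Go Ga (uh.1.1 a Ga).
have /andP[d0 d1] := dd; have K1 := growth_constant_ge1 N k.
set r := d / (16 * growth_constant N k ^+ 2).
have r0 : 0 < r by rewrite divr_gt0 // mulr_gt0 // exprn_gt0 //; lra.
apply/nbhs_cubeP; exists r => // x xr.
set y := x - a; have yr i : `|y 0 i| <= r by rewrite !mxE; exact: xr.
have -> : u x = u (a + y) by rewrite /y addrC subrK.
clearbody y; have FT := @summability.totally_filter {ffun 'I_N -> nat}.
apply/cvgrPdist_le => e e0.
(* One share 2^-n M is for the Taylor remainder, two for the geometric tail of the degrees from n
   on. *)
have [n nP] : exists n, 3 * (2^-1 ^+ n * M) <= e.
  have M3 : 0 < e / (3 * M) by rewrite divr_gt0 // mulr_gt0.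
  have [n nM] := half_power_small M3; exists n.
  by move: nM; rewrite ltr_pdivlMr ?mulr_gt0 //; lra.
(* All multi-indices of degree below n. A finite set A containing them carries the full jets of
   order below n; its further terms form partial sums of higher jets. *)
pose s := [seq word_type w | m <- iota 0 n, w <- words N m].
pose A0 : {fset {ffun 'I_N -> nat}} := [fset z in s]%fset.
exists A0 => // A A0A.
have [L [nL AL]] : exists L, (n <= L)%N /\ (forall alpha, alpha \in A -> (degree alpha < L)%N).
  exists (maxn n (\max_(alpha <- A) (degree alpha).+1)); split; first exact: leq_maxl.
  by move=> alpha aA; rewrite leq_max; apply/orP; right; exact: (@leq_bigmax_seq _ _ _ (fun alpha => (degree alpha).+1)).
rewrite /= /summability.partial_sum.
rewrite -(big_seq_fsetE _ A xpredT (fun alpha => taylor_coef u a alpha * monomial alpha y)) /=.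
rewrite (sum_taylor_terms u a y AL) (big_cat_nat (leq0n n) nL) //=.
have -> : \sum_(0 <= m < n) (\sum_(w <- words N m | word_type w \in A)
     word_monomial w y * dpart w u a) / m`!%:R = \sum_(m < n) jet m y u a / m`!%:R.
  rewrite big_mkord; apply: eq_bigr => m _; congr (_ / _).
  rewrite /jet [RHS]big_seq [LHS]big_seq_cond; apply: eq_bigl => w.
  case wm : (w \in _) => //=; apply: (fsubsetP A0A); rewrite in_fset /=.
  apply/allpairsPdep; exists (m : nat), w; split => //.
  by rewrite mem_iota add0n /=.
rewrite opprD addrA; apply: le_trans (ler_normB _ _) _.
apply: le_trans nP; have -> : 3 * (2^-1 ^+ n * M) = 2^-1 ^+ n * M + 2 * 2^-1 ^+ n * M by ring.
apply: lerD; first exact: helmholtz_taylor Go uh dd M0 aG uM yr.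
apply: le_trans (ler_norm_sum _ _ _) _.
apply: le_trans (_ : (\sum_(n <= m < L) (2^-1 : R) ^+ m) * M <= _); last first.
  by rewrite ler_wpM2r ?geometric_tail // ltW.
rewrite mulr_suml; apply: ler_sum => m _.
rewrite normrM normfV (ger0_norm (ler0n R _)) ler_pdivrMr ?ltr0n ?fact_gt0 // [X in _ <= X]mulrC.
apply: le_trans (ler_norm_sum _ _ _) _.
have ac : cube a (d / 2) a by apply: cube_center; lra.
apply: le_trans (jet_norm_bound m Go uh dd M0 aG uM ac yr).
rewrite [X in _ <= X](bigID (fun w => word_type w \in A)) /= lerDl.
by apply: sumr_ge0.
Qed.

End Analyticity.

(** * Unique continuation *)

Section Continuation.
Variables (R : realType) (N : nat).
Implicit Types (a x y : 'rV[R]_N) (d e h t k : R) (f g u : 'rV[R]_N -> R).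

(** All Taylor polynomials vanish, and the remainder tends to 0 on a cube whose size does not depend
    on the order. *)
Lemma zero_near_of_jets k (G : set 'rV[R]_N) u x : open G ->
  helmholtz_solution G k u -> G x -> (forall w, dpart w u x = 0) ->
  \forall y \near x, u y = 0.
Proof.
move=> Go uh Gx jet0.
have [d [M [dd M0 aG uM]]] := local_bound Go Gx (uh.1.1 x Gx).
have /andP[d0 d1] := dd; have K1 := growth_constant_ge1 N k.
set r := d / (16 * growth_constant N k ^+ 2).
have r0 : 0 < r by rewrite divr_gt0 // mulr_gt0 // exprn_gt0 //; lra.
apply/nbhs_cubeP; exists r => // y yr.
have yr' i : `|(y - x) 0 i| <= r by rewrite !mxE; exact: yr.
apply/eqP; rewrite -normr_le0; apply/ler_addgt0Pr => e e0; rewrite add0r.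
have M3 : 0 < e / M by exact: divr_gt0.
have [n] := half_power_small M3; rewrite ltr_pdivlMr // => /ltW; apply: le_trans.
have := helmholtz_taylor n Go uh dd M0 aG uM yr'.
rewrite (addrC x (y - x)) subrK big1 ?subr0 // => m _.
by rewrite /jet big1 ?mul0r // => w _; rewrite jet0 mulr0.
Qed.

Lemma dpart_zero_near u x w : (\forall y \near x, u y = 0) ->
  \forall y \near x, dpart w u y = 0.
Proof.
move=> u0; elim: w => //= i w /nbhs_interior; apply: filterS => y yw.
have -> : partial i (dpart w u) y = partial i (fun=> 0) y by exact: near_eq_partial.
exact: derive_cst.
Qed.

(** The zeros of infinite order form a subset of G that is relatively open by Taylor expansion and
    relatively closed by continuity of all derivatives. *)
Lemma unique_continuation k (G : set 'rV[R]_N) u : open G -> connected G ->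
  helmholtz_solution G k u -> (exists x, G x /\ u x <> 0) ->
  forall x, G x -> exists w, dpart w u x != 0.
Proof.
move=> Go Gc uh [x0 [Gx0 ux0]] x Gx; apply: contrapT => nx.
pose Z := [set x | G x /\ forall w, dpart w u x = 0].
have Zx : Z x by split => // w; apply/eqP/negPn/negP => wx; apply: nx; exists w.
suff ZG : Z = G by move: Gx0; rewrite -ZG => -[_ /(_ [::])].
apply: Gc; first by exists x.
  exists Z; last by apply/seteqP; split => [y [? ?]|y []].
  rewrite openE => y [Gy jy].
  have u0 := zero_near_of_jets Go uh Gy jy.
  have nG : nbhs y G by exact: open_nbhs_nbhs.
  apply: filterS2 nG (nbhs_interior u0) => z Gz uz; split => // w.
  exact: nbhs_singleton (dpart_zero_near w uz).
exists (closure Z); first exact: closed_closure.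
apply/seteqP; split => [y Zy|y [Gy cy]]; first by split; [case: Zy|exact: subset_closure].
split => // w; apply/eqP/negPn/negP => wy.
have n0 : 0 < `|dpart w u y| by rewrite normr_gt0.
have /continuous_cubeP/(_ _ n0)[d d0 dP] := (helmholtz_dpart w Go uh).1.1 y Gy.
have [z [[_ zw] /dP]] := cy _ (nbhs_cube y d0).
by rewrite zw sub0r normrN ltxx.
Qed.

Lemma nonzero_near k (G : set 'rV[R]_N) u : open G -> connected G ->
  helmholtz_solution G k u -> (exists x, G x /\ u x <> 0) ->
  forall x d, G x -> 0 < d -> exists y, [/\ cube x d y, G y & u y != 0].
Proof.
move=> Go Gc uh u0 x d Gx d0.
have [w wx] := unique_continuation Go Gc uh u0 Gx.
apply: contrapT => H.
have : \forall y \near x, u y = 0.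
  have [d' d'0 dG] := open_cubeP Go Gx.
  apply/nbhs_cubeP; exists (Num.min d d'); first by rewrite lt_min d0.
  move=> y yd; apply/eqP/negPn/negP => uy; apply: H; exists y; split => //.
  - by apply: cubeS yd; rewrite ge_min lexx.
  - by apply: dG; apply: cubeS yd; rewrite ge_min lexx orbT.
by move=> /(dpart_zero_near w)/nbhs_singleton E; rewrite E eqxx in wx.
Qed.

End Continuation.

(** * Segments, convex sets and connected components *)

Section Segments.
Variables (R : realType) (N : nat).
Implicit Types (a x y z : 'rV[R]_N) (d e h t s k : R) (A B : set 'rV[R]_N).

Definition seg x y : set 'rV[R]_N := [set x + t *: (y - x) | t in `[0, 1]%classic].

Lemma seg_continuous x y : continuous (fun t : R => x + t *: (y - x) : 'rV[R]_N).
Proof.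
move=> t; apply: cvgD; first exact: cvg_cst.
by apply: cvgZ; [exact: cvg_id|exact: cvg_cst].
Qed.

Lemma connected_seg x y : connected (seg x y).
Proof.
apply: connected_continuous_connected; first exact: segment_connected.
by apply: continuous_subspaceT; exact: seg_continuous.
Qed.

Lemma seg_left x y : seg x y x.
Proof. by exists 0; rewrite /= ?in_itv /= ?lexx ?ler01 // scale0r addr0. Qed.

Lemma seg_right x y : seg x y y.
Proof. by exists 1; rewrite /= ?in_itv /= ?lexx ?ler01 // scale1r addrC subrK. Qed.

Lemma lerp_coord x y t j : (x + t *: (y - x)) 0 j = (1 - t) * x 0 j + t * y 0 j.
Proof. by rewrite !mxE; ring. Qed.

Lemma seg_coord x y z j : seg x y z ->
  exists2 t, 0 <= t <= 1 & z 0 j = (1 - t) * x 0 j + t * y 0 j.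
Proof.
by move=> [t /= + <-]; rewrite in_itv /= => t01; exists t => //; rewrite lerp_coord.
Qed.

Definition convex_box A : Prop := forall x y, A x -> A y -> seg x y `<=` A.

Lemma connected_convex A : convex_box A -> connected A.
Proof.
move=> Ac; have [->|/set0P[x Ax]] := eqVneq A set0; first exact: connected0.
have -> : A = \bigcup_(y in A) seg x y.
  apply/seteqP; split => [y Ay|z [y Ay]]; first by exists y => //; exact: seg_right.
  exact: Ac.
apply: bigcup_connected; last by move=> y _; exact: connected_seg.
by exists x => y _; exact: seg_left.
Qed.

Lemma convex_cube a d : convex_box (cube a d).
Proof.
move=> x y xd yd z zs j; have [t /andP[t0 t1] ->] := seg_coord j zs.
have -> : (1 - t) * x 0 j + t * y 0 j - a 0 j =
  (1 - t) * (x 0 j - a 0 j) + t * (y 0 j - a 0 j) by ring.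
have t1' : 0 <= 1 - t by lra.
apply: le_trans (ler_normD _ _) _; rewrite !normrM (ger0_norm t0) (ger0_norm t1').
have H1 := ler_wpM2l t1' (xd j); have H2 := ler_wpM2l t0 (yd j).
by lra.
Qed.

Lemma component_seg A p x y : connected_component A p x -> seg x y `<=` A ->
  connected_component A p y.
Proof.
move=> px xyA; apply: connected_component_trans px _.
by apply: (connected_component_max _ xyA (@connected_seg x y));
  [exact: seg_left|exact: seg_right].
Qed.

Lemma open_component A p : open A -> open (connected_component A p).
Proof.
move=> Ao; apply: open_of_cube => x px.
have Ax := connected_component_sub px.
have [d d0 dA] := open_cubeP Ao Ax; exists d => // y yd.
apply: connected_component_trans px _.
apply: (connected_component_max _ dA (connected_convex (@convex_cube x d))) => //.
by apply: cube_center; exact: ltW.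
Qed.

End Segments.

(** * The nodal set near a regular zero *)

Section RegularPoint.
Variables (R : realType) (N : nat) (G : set 'rV[R]_N) (f : 'rV[R]_N -> R)
  (i : 'I_N) (x0 : 'rV[R]_N) (r : R).
Implicit Types (y z : 'rV[R]_N) (t s e d : R).
Hypotheses (G_open : open G) (f_C1 : class_C 1 G f) (r_gt0 : 0 < r)
  (cubeG : cube x0 r `<=` G) (f_x0 : f x0 = 0)
  (df_gt0 : forall y, cube x0 r y -> 0 < partial i f y).

Let f_continuous y : G y -> {for y, continuous f}.
Proof. exact: f_C1.1. Qed.

Let nonzero := G `\` nodal_set G f.

Lemma open_nonzero : open nonzero.
Proof.
apply: open_of_cube => y [Gy ny].
have fy : f y != 0 by apply/eqP => fy; exact: ny.
have [d1 d10 dG] := open_cubeP G_open Gy.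
have n0 : 0 < `|f y| by rewrite normr_gt0.
have [d2 d20 H] := (continuous_cubeP _ _).1 (f_continuous Gy) _ n0.
exists (Num.min d1 d2); first by rewrite lt_min d10.
move=> z zd; have z1 : cube y d1 z by apply: cubeS zd; rewrite ge_min lexx.
have z2 : cube y d2 z by apply: cubeS zd; rewrite ge_min lexx orbT.
split; first exact: dG.
by move=> [_ fz]; have := H _ z2; rewrite fz sub0r normrN ltxx.
Qed.

(** Slides y along the i-th axis to height t, measured from x0; the other coordinates of y select
    the vertical line. *)
Definition level t y : 'rV[R]_N := y + (x0 0 i + t - y 0 i) *: basis i.

Lemma levelE t y j : level t y 0 j = if j == i then x0 0 i + t else y 0 j.
Proof. by rewrite shiftE; case: eqP => [->|_]; ring. Qed.

Lemma level_id t y : y 0 i = x0 0 i + t -> level t y = y.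
Proof. by move=> yi; rewrite /level yi subrr scale0r addr0. Qed.

Lemma level_shift t s y : level s y = level t y + (s - t) *: basis i.
Proof.
apply/rowP => j; rewrite levelE [RHS]shiftE levelE.
by case: (j == i); ring.
Qed.

Lemma level_cube t y : cube x0 r y -> `|t| <= r -> cube x0 r (level t y).
Proof.
by move=> yr tr j; rewrite levelE; case: eqP => [->|_]; rewrite // addrAC subrr add0r.
Qed.

Lemma level_increasing y t s : cube x0 r y -> - r <= t -> t < s -> s <= r ->
  f (level t y) < f (level s y).
Proof.
move=> yr tr ts sr; have st0 : 0 < s - t by rewrite subr_gt0.
have lc c : 0 <= c <= s - t -> cube x0 r (level t y + c *: basis i).
  move=> c01; rewrite -[c](addrK t) -level_shift; apply: level_cube => //.
  by rewrite ler_norml; lra.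
have sub c : c \in `[0, s - t] -> 0 <= c <= s - t by rewrite in_itv.
have D c : 0 <= c <= s - t -> is_derive c 1 (fun u => f (level t y + u *: basis i))
    (partial i f (level t y + c *: basis i)).
  by move=> /lc c01; apply: is_derive_line; apply: (f_C1.2 i).1; exact: cubeG.
have D' c : c \in `]0, s - t[ -> is_derive c 1 (fun u => f (level t y + u *: basis i))
    (partial i f (level t y + c *: basis i)).
  by move/subset_itv_oo_cc/sub; exact: D.
have W : {within `[0, s - t], continuous (fun u => f (level t y + u *: basis i))}.
  by apply: derivable_within_continuous => c /sub /D [].
have [c /subset_itv_oo_cc/sub c01] := MVT st0 D' W.
rewrite -level_shift scale0r addr0 => E.
by rewrite -subr_gt0 E subr0; apply: mulr_gt0 => //; apply: df_gt0; exact: lc.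
Qed.

(** On the vertical line through x0, f is negative at the bottom and positive at the top; continuity
    at these two points extends the signs to neighbouring lines. *)
Lemma exists_level_radius : exists2 s, 0 < s <= r &
  forall y, cube x0 s y -> f (level (- r) y) < 0 < f (level r y).
Proof.
have x0r : cube x0 r x0 by apply: cube_center; exact: ltW.
have E0 : level 0 x0 = x0 by apply: level_id; rewrite addr0.
have r0 : - r <= 0 by rewrite oppr_le0 ltW.
have fp : f x0 < f (level r x0).
  by rewrite -[X in f X < _]E0; exact: level_increasing.
have fm : f (level (- r) x0) < f x0.
  by rewrite -[X in _ < f X]E0; apply: level_increasing => //; [rewrite oppr_lt0|exact: ltW].
rewrite f_x0 in fp fm.
have Gl t : `|t| <= r -> G (level t x0) by move=> tr; apply: cubeG; exact: level_cube.
have nr : `|r| = r by rewrite gtr0_norm.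
have fm' : 0 < - f (level (- r) x0) by lra.
have Gp : G (level r x0) by apply: Gl; rewrite nr.
have Gm : G (level (- r) x0) by apply: Gl; rewrite normrN nr.
have [d1 d10 H1] := (continuous_cubeP _ _).1 (f_continuous Gp) _ fp.
have [d2 d20 H2] := (continuous_cubeP _ _).1 (f_continuous Gm) _ fm'.
exists (Num.min r (Num.min d1 d2)); first by rewrite !lt_min ge_min r_gt0 d10 d20 lexx.
move=> y ys.
have lc t : cube (level t x0) (Num.min d1 d2) (level t y).
  move=> j; rewrite !levelE; case: eqP => _.
    by rewrite subrr normr0 le_min !ltW.
  by apply: le_trans (ys j) _; rewrite ge_min lexx orbT.
have := H1 (level r y) _; have := H2 (level (- r) y) _.
rewrite !ltr_norml => h2 h1.
have /h1/andP[] : cube (level r x0) d1 (level r y).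
  by apply: cubeS (lc r); rewrite ge_min lexx.
have /h2/andP[] : cube (level (- r) x0) d2 (level (- r) y).
  by apply: cubeS (lc (- r)); rewrite ge_min lexx orbT.
by lra.
Qed.

Variable s : R.
Hypotheses (s_gt0 : 0 < s <= r)
  (level_sign : forall y, cube x0 s y -> f (level (- r) y) < 0 < f (level r y)).

(** Height r along axis i and width s along the others, so that each vertical line runs from a
    negative bottom to a positive top. *)
Definition graph_box : set 'rV[R]_N :=
  [set y | forall j, `|y 0 j - x0 0 j| < if j == i then r else s].

Lemma open_graph_box : open graph_box.
Proof.
apply: open_of_cube => y yO.
have [d d0 H] : exists2 d, 0 < d & forall j,
    d <= ((if j == i then r else s) - `|y 0 j - x0 0 j|) / 2.
  apply: (@uniform_radius R _ (fun j d => d <=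
    ((if j == i then r else s) - `|y 0 j - x0 0 j|) / 2)); last first.
    by move=> j d d' dd'; exact: le_trans.
  by move=> j; eexists; last exact: lexx; rewrite divr_gt0 // subr_gt0.
exists d => // z zd j.
have -> : z 0 j - x0 0 j = (z 0 j - y 0 j) + (y 0 j - x0 0 j) by ring.
apply: le_lt_trans (ler_normD _ _) _.
have := zd j; have := H j; have := yO j; lra.
Qed.

Lemma graph_box_center : graph_box x0.
Proof.
have /andP[s0 sr] := s_gt0.
by move=> j; rewrite subrr normr0; case: ifP.
Qed.

Lemma graph_box_cube : graph_box `<=` cube x0 r.
Proof.
have /andP[s0 sr] := s_gt0.
by move=> y yO j; have := yO j; case: ifP => _; lra.
Qed.

Lemma convex_graph_box : convex_box graph_box.
Proof.
move=> x y xd yd z zs j; have [t /andP[t0 t1] ->] := seg_coord j zs.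
have -> : (1 - t) * x 0 j + t * y 0 j - x0 0 j =
  (1 - t) * (x 0 j - x0 0 j) + t * (y 0 j - x0 0 j) by ring.
have t1' : 0 <= 1 - t by lra.
apply: le_lt_trans (ler_normD _ _) _; rewrite !normrM (ger0_norm t0) (ger0_norm t1').
have pb := xd j; have qb := yd j.
have [->|tn] := eqVneq t 0; first by rewrite subr0 mul1r mul0r addr0.
have tp : 0 < t by rewrite lt_def tn.
have H1 := ler_wpM2l t1' (ltW pb).
rewrite -(ltr_pM2l tp) in qb.
by lra.
Qed.

Lemma graph_box_level y t : graph_box y -> `|t| < r -> graph_box (level t y).
Proof.
move=> yO tr j; rewrite levelE; case: eqP => [->|/eqP ji].
  by rewrite addrAC subrr add0r.
by have := yO j; rewrite (negPf ji).
Qed.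

Lemma graph_box_sign y : graph_box y -> f (level (- r) y) < 0 < f (level r y).
Proof.
move=> yO; have /andP[s0 sr] := s_gt0.
have E t : level t y = level t (level 0 y).
  by apply/rowP => j; rewrite !levelE; case: eqP.
rewrite (E r) (E (- r)); apply: level_sign => j; rewrite levelE.
case: eqP => [->|/eqP ji]; first by rewrite addr0 subrr normr0 ltW.
by have := yO j; rewrite (negPf ji) => /ltW.
Qed.

(* The path runs vertically from y to the face at height e and then along
   that face, where f has constant sign. *)
Lemma component_of_face e y : `|e| = r -> graph_box y ->
  (forall u, 0 <= u <= 1 ->
     f (level ((1 - u) * (y 0 i - x0 0 i) + u * e) y) != 0) ->
  connected_component nonzero (level e x0) y.
Proof.
move=> er yO fy; have yr := graph_box_cube yO.
have /andP[s0 sr] := s_gt0.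
pose t := y 0 i - x0 0 i.
have Ey : level t y = y by apply: level_id; rewrite /t; ring.
have nz z : cube x0 r z -> f z != 0 -> nonzero z.
  by move=> zr fz; split; [exact: cubeG|move=> [_ z0]; rewrite z0 eqxx in fz].
apply: connected_component_sym.
apply: (@component_seg _ _ _ _ (level e y)).
  apply: (@component_seg _ _ _ y).
    apply: connected_component_refl; apply: nz => //.
    by have := fy 0; rewrite subr0 mul1r mul0r addr0 Ey; apply; rewrite lexx ler01.
  move=> z [u /= + <-]; rewrite in_itv /= => u01.
  have -> : y + u *: (level e y - y) = level ((1 - u) * t + u * e) y.
    apply/rowP => j; rewrite lerp_coord !levelE.
    by case: eqP => [->|_]; rewrite /t; ring.
  apply: nz; last exact: fy.
  apply: level_cube => //; apply: le_trans (ler_normD _ _) _.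
  have /andP[u0 u1] := u01; have u1' : 0 <= 1 - u by lra.
  rewrite !normrM er (ger0_norm u0) (ger0_norm u1').
  by have := ler_wpM2l u1' (yr i); rewrite -/t; lra.
move=> z zs.
have zE : z = level e z.
  apply/esym/level_id; have [u _ ->] := seg_coord i zs.
  by rewrite !levelE eqxx; ring.
have zO : graph_box (level 0 z).
  move=> j; rewrite levelE; case: eqP => [->|/eqP ji].
    by rewrite addr0 subrr normr0.
  have [u /andP[u0 u1] ->] := seg_coord j zs.
  rewrite !levelE (negPf ji); have := yO j; rewrite (negPf ji) => yj.
  have -> : (1 - u) * y 0 j + u * x0 0 j - x0 0 j = (1 - u) * (y 0 j - x0 0 j) by ring.
  rewrite normrM ger0_norm; last by lra.
  by apply: le_lt_trans yj; apply: ler_piMl => //; lra.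
have Ee : level e (level 0 z) = z.
  by rewrite [RHS]zE; apply/rowP => j; rewrite !levelE; case: eqP.
apply: nz.
  rewrite -Ee; apply: level_cube; first exact: graph_box_cube.
  by rewrite er.
have /andP[fm fp] := graph_box_sign zO.
rewrite -Ee; have [e0|e0] := leP 0 e.
  by rewrite (_ : e = r) ?gt_eqF // -er ger0_norm.
by rewrite (_ : e = - r) ?lt_eqF // -er ltr0_norm // opprK.
Qed.

Lemma positive_component y : graph_box y -> 0 < f y ->
  connected_component nonzero (level r x0) y.
Proof.
move=> yO fy; have yr := graph_box_cube yO.
apply: component_of_face => //; first by rewrite gtr0_norm.
move=> u /andP[u0 u1]; set t := y 0 i - x0 0 i.
have Ey : level t y = y by apply: level_id; rewrite /t; ring.
have /andP[t1 t2] : - r <= t <= r by have := yr i; rewrite ler_norml.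
have tr : 0 <= u * (r - t) <= r - t.
  by rewrite mulr_ge0 ?subr_ge0 //=; apply: ler_piMl; rewrite ?subr_ge0.
have -> : (1 - u) * t + u * r = t + u * (r - t) by ring.
rewrite gt_eqF //; have [->|un] := eqVneq (u * (r - t)) 0; first by rewrite addr0 Ey.
apply: lt_trans fy _; rewrite -[X in f X < _]Ey; apply: level_increasing => //.
  by rewrite ltrDl lt_def un; case/andP: tr.
by lra.
Qed.

Lemma negative_component y : graph_box y -> f y < 0 ->
  connected_component nonzero (level (- r) x0) y.
Proof.
move=> yO fy; have yr := graph_box_cube yO.
apply: component_of_face => //; first by rewrite normrN gtr0_norm.
move=> u /andP[u0 u1]; set t := y 0 i - x0 0 i.
have Ey : level t y = y by apply: level_id; rewrite /t; ring.
have /andP[t1 t2] : - r <= t <= r by have := yr i; rewrite ler_norml.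
have tr : 0 <= u * (r + t) <= r + t.
  have rt : 0 <= r + t by lra.
  by rewrite mulr_ge0 //=; apply: ler_piMl.
have -> : (1 - u) * t + u * (- r) = t - u * (r + t) by ring.
rewrite lt_eqF //; have [->|un] := eqVneq (u * (r + t)) 0; first by rewrite subr0 Ey.
apply: lt_trans fy; rewrite -[X in _ < f X]Ey; apply: level_increasing => //.
  by lra.
by rewrite ltrBlDr ltrDl lt_def un; case/andP: tr.
Qed.

Definition zero_graph : set 'rV[R]_N := nodal_set G f `&` graph_box.

Lemma level_root y : graph_box y ->
  exists t, [/\ - r < t, t < r & f (level t y) = 0].
Proof.
move=> yO; have yr := graph_box_cube yO; have /andP[fm fp] := graph_box_sign yO.
have r0 := r_gt0; have rr : - r <= r by lra.
have W : {within `[- r, r], continuous (fun t => f (level t y))}.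
  apply: derivable_within_continuous => t; rewrite in_itv /= => /andP[t1 t2].
  have E : (fun t => f (level t y)) = (fun t => f (level 0 y + t *: basis i)).
    by apply/funext => u; rewrite (level_shift 0) subr0.
  rewrite E; have [] // : is_derive t 1 (fun t => f (level 0 y + t *: basis i))
    (partial i f (level 0 y + t *: basis i)).
  apply: is_derive_line; apply: (f_C1.2 i).1; apply: cubeG.
  rewrite -{1}[t]subr0 -level_shift; apply: level_cube => //.
  by rewrite ler_norml t1.
have [|t] := @IVT R (fun t => f (level t y)) (- r) r 0 rr W.
  by rewrite ge_min le_max (ltW fm) (ltW fp) orbT.
rewrite in_itv /= => /andP[t1 t2] ft; exists t; split => //.
- rewrite lt_neqAle t1 andbT; apply/eqP => E.
  by rewrite -E in ft; rewrite ft ltxx in fm.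
- rewrite lt_neqAle t2 andbT; apply/eqP => E.
  by rewrite E in ft; rewrite ft ltxx in fp.
Qed.

Lemma level_root_unique y t t' : graph_box y -> - r <= t <= r -> - r <= t' <= r ->
  f (level t y) = 0 -> f (level t' y) = 0 -> t = t'.
Proof.
move=> yO /andP[a1 a2] /andP[b1 b2] ft ft'; have yr := graph_box_cube yO.
case: (ltrgtP t t') => // tt.
- by have := level_increasing yr a1 tt b2; rewrite ft ft' ltxx.
- by have := level_increasing yr b1 tt a2; rewrite ft ft' ltxx.
Qed.

(** The zero set is the image of the convex box under the map sliding each point to the unique root
    on its vertical line; it remains to see that the root depends continuously on the line. *)
Lemma connected_zero_graph : connected zero_graph.
Proof.
have /choice[T TP] : forall y, exists t, graph_box y -> [/\ - r < t, t < r & f (level t y) = 0].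
  move=> y; have [yO|nO] := pselect (graph_box y); last by exists 0.
  by have [t tP] := level_root yO; exists t.
have -> : zero_graph = [set level (T y) y | y in graph_box].
  apply/seteqP; split => [z [[Gz fz] zO]|z [y yO <-]].
    exists z => //; have [t1 t2 ft] := TP z zO.
    pose t := z 0 i - x0 0 i.
    have Ez : level t z = z by apply: level_id; rewrite /t; ring.
    rewrite -[RHS]Ez; congr level; apply: (level_root_unique zO) => //.
    - by rewrite !ltW.
    - by have := graph_box_cube zO i; rewrite ler_norml.
    - by rewrite Ez.
  have [t1 t2 ft] := TP y yO.
  have tO : graph_box (level (T y) y).
    by apply: graph_box_level => //; rewrite ltr_norml t1.
  by split => //; split => //; apply: cubeG; exact: graph_box_cube.
apply: connected_continuous_connected.
  exact: connected_convex convex_graph_box.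
apply: (@continuous_in_subspaceT _ _ graph_box) => y /set_mem yO.
have [t1 t2 ft] := TP y yO; have yr := graph_box_cube yO.
move=> P /nbhs_cubeP[e' e'0 eP].
(* Shrunk so that the heights T y - e and T y + e stay within [-r, r]. The opposite signs of f there
   persist for nearby z and trap the root T z between them. *)
pose e := Num.min e' (Num.min (r - T y) (T y + r)).
have e0 : 0 < e by rewrite !lt_min e'0; lra.
have := lexx e; rewrite {2}/e !le_min => /and3P[ee' e1 e2]; clearbody e.
have lr t : - r <= t <= r -> G (level t y).
  by move=> tr; apply: cubeG; apply: level_cube => //; rewrite ler_norml.
have fp : 0 < f (level (T y + e) y) by rewrite -[X in X < _]ft; apply: level_increasing => //; lra.
have fm : 0 < - f (level (T y - e) y).
  by rewrite oppr_gt0 -[X in _ < X]ft; apply: level_increasing => //; lra.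
have Gp : G (level (T y + e) y) by apply: lr; lra.
have Gm : G (level (T y - e) y) by apply: lr; lra.
have [d1 d10 H1] := (continuous_cubeP _ _).1 (f_continuous Gp) _ fp.
have [d2 d20 H2] := (continuous_cubeP _ _).1 (f_continuous Gm) _ fm.
have [d3 d30 H3] := open_cubeP open_graph_box yO.
apply/nbhs_cubeP; exists (Num.min (Num.min d1 d2) (Num.min d3 e)).
  by rewrite !lt_min d10 d20 d30.
move=> z zd; apply: eP => /=.
have [zd1 zd2 zd3 ze] : [/\ cube y d1 z, cube y d2 z, cube y d3 z & cube y e z].
  by split; apply: cubeS zd; rewrite !ge_min lexx ?orbT.
have zO := H3 z zd3; have zr := graph_box_cube zO.
have lc t d : 0 <= d -> cube y d z -> cube (level t y) d (level t z).
  by move=> d0 yz j; rewrite !levelE; case: eqP => _; rewrite ?subrr ?normr0.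
have := H1 _ (lc (T y + e) d1 (ltW d10) zd1).
have := H2 _ (lc (T y - e) d2 (ltW d20) zd2).
rewrite !ltr_norml => /andP[_ h2] /andP[h1 _].
have [z1 z2 fz] := TP z zO.
have ye1 : T y - e <= r by lra.
have ye2 : - r <= T y + e by lra.
have Tm : T y - e <= T z.
  rewrite leNgt; apply/negP => lt; have := level_increasing zr (ltW z1) lt ye1.
  by rewrite fz; lra.
have Tp : T z <= T y + e.
  rewrite leNgt; apply/negP => lt; have := level_increasing zr ye2 lt (ltW z2).
  by rewrite fz; lra.
move=> j; rewrite !levelE; case: eqP => _; last by apply: le_trans (ze j) ee'.
by rewrite ler_norml; lra.
Qed.

(** Arbitrarily small moves up or down from z enter the positive or the negative component, and z
    itself, a zero of f, belongs to no component. *)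
Lemma zero_graph_boundary z : zero_graph z ->
  boundary (connected_component nonzero (level r x0)) z /\
  boundary (connected_component nonzero (level (- r) x0)) z.
Proof.
move=> [[Gz fz] zO]; have zr := graph_box_cube zO.
have nA p : ~ connected_component nonzero p z.
  by move=> /connected_component_sub [_ nz]; exact: nz.
have nI p : ~ interior (connected_component nonzero p) z.
  by move=> /interior_subset; exact: nA.
pose t := z 0 i - x0 0 i.
have Ez : level t z = z by apply: level_id; rewrite /t; ring.
have tr : - r < t < r by have := zO i; rewrite eqxx ltr_norml.
have cl e : 0 < e -> exists c, [/\ 0 < c, c <= e, - r < t - c & t + c < r].
  move=> e0; pose m := Num.min e (Num.min (r - t) (t + r)).
  have m0 : 0 < m by rewrite !lt_min e0; lra.
  have := lexx m; rewrite {2}/m !le_min => /and3P[m1 m2 m3]; clearbody m.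
  by exists (m / 2); split; lra.
split; split => // P /nbhs_cubeP[e e0 eP]; have [c [c0 ce c1 c2]] := cl e e0.
- exists (level (t + c) z); split.
    apply: positive_component; first by apply: graph_box_level => //; rewrite ltr_norml; lra.
    by rewrite -fz -[X in f X < _]Ez; apply: level_increasing => //; lra.
  apply: eP; rewrite -[X in cube X]Ez (level_shift t (t + c)) (addrC t) addrK.
  by apply: cubeS (cube_shift _ _ _); rewrite gtr0_norm.
- exists (level (t - c) z); split.
    apply: negative_component; first by apply: graph_box_level => //; rewrite ltr_norml; lra.
    by rewrite -fz -[X in _ < f X]Ez; apply: level_increasing => //; lra.
  apply: eP; rewrite -[X in cube X]Ez (level_shift t (t - c)) (addrC t) addrK.
  by apply: cubeS (cube_shift _ _ _); rewrite normrN gtr0_norm.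
Qed.

End RegularPoint.

(** * Edges between nodal domains *)

Section NodalEdges.
Variables (R : realType) (N : nat).
Implicit Types (G : set 'rV[R]_N) (x y z : 'rV[R]_N) (f u : 'rV[R]_N -> R).

Lemma regular_point_pos G f i x0 : open G -> class_C 1 G f -> G x0 ->
  f x0 = 0 -> 0 < partial i f x0 ->
  exists O A B, [/\ [/\ open O, O x0 & O `<=` G],
    nodal_domain G f A /\ nodal_domain G f B,
    connected (nodal_set G f `&` O) /\ (forall y, O y -> partial i f y != 0),
    forall z, (nodal_set G f `&` O) z -> boundary A z /\ boundary B z &
    forall y, O y -> f y != 0 -> A y \/ B y].
Proof.
move=> Go fC Gx0 fx0 df.
have [d1 d10 dG] := open_cubeP Go Gx0.
have [d2 d20 H2] := (continuous_cubeP _ _).1 ((fC.2 i).2.1 _ Gx0) _ df.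
pose r := Num.min d1 d2.
have r0 : 0 < r by rewrite lt_min d10.
have cG : cube x0 r `<=` G.
  by move=> y yr; apply: dG; apply: cubeS yr; rewrite ge_min lexx.
have dfr y : cube x0 r y -> 0 < partial i f y.
  move=> yr; have : `|partial i f y - partial i f x0| < partial i f x0.
    by apply: H2; apply: cubeS yr; rewrite ge_min lexx orbT.
  by rewrite ltr_norml; lra.
clearbody r.
have [s sr sgn] := exists_level_radius fC r0 cG fx0 dfr.
have OG : graph_box i x0 r s `<=` G by move=> y /(graph_box_cube sr); exact: cG.
have OC := graph_box_center i x0 r0 sr.
have nd e : `|e| = r -> f (level i x0 e x0) != 0 ->
    nodal_domain G f (connected_component (G `\` nodal_set G f) (level i x0 e x0)).
  move=> er fe; exists (level i x0 e x0) => //; split.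
    apply: cG; apply: level_cube; first by apply: cube_center; exact: ltW.
    by rewrite er.
  by move=> [_ E]; rewrite E eqxx in fe.
have /andP[fm fp] := graph_box_sign sr sgn OC.
exists (graph_box i x0 r s),
  (connected_component (G `\` nodal_set G f) (level i x0 r x0)),
  (connected_component (G `\` nodal_set G f) (level i x0 (- r) x0)).
split.
- by split => //; exact: open_graph_box.
- split; apply: nd; first by rewrite gtr0_norm.
  + by rewrite gt_eqF.
  + by rewrite normrN gtr0_norm.
  + by rewrite lt_eqF.
- split; first exact: (connected_zero_graph fC r0 cG dfr sr sgn).
  by move=> y /(graph_box_cube sr)/dfr; exact: lt0r_neq0.
- by move=> z; exact: (zero_graph_boundary fC r0 cG dfr sr sgn).
- move=> y yO; rewrite neq_lt => /orP[fy|fy].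
    by right; exact: (negative_component fC r0 cG dfr sr sgn).
  by left; exact: (positive_component fC r0 cG dfr sr sgn).
Qed.

Definition nodal_edge G u A B : Prop :=
  exists S, regular_portion G u S /\ S `<=` boundary A `&` boundary B.

Lemma nodal_edge_sym G u A B : nodal_edge G u A B -> nodal_edge G u B A.
Proof. by move=> [S [? SA]]; exists S; split => // x /SA []. Qed.

Lemma regular_point k G u i x0 : open G -> helmholtz_solution G k u -> G x0 ->
  u x0 = 0 -> partial i u x0 != 0 ->
  exists O A B, [/\ open O, O x0, nodal_domain G u A /\ nodal_domain G u B,
    nodal_edge G u A B & forall y, O y -> u y != 0 -> A y \/ B y].
Proof.
move=> Go uh Gx0 ux0 du.
have uC : class_C 1 G u.
  have [[c u1] _] := uh.
  by split => // j; split; [exact: (u1 j).1|split => //; exact: (u1 j).2.1].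
suff H :
  exists O A B, [/\ [/\ open O, O x0 & O `<=` G],
    nodal_domain G u A /\ nodal_domain G u B,
    connected (nodal_set G u `&` O) /\ (forall y, O y -> partial i u y != 0),
    forall z, (nodal_set G u `&` O) z -> boundary A z /\ boundary B z &
    forall y, O y -> u y != 0 -> A y \/ B y].
  have [V [A [B [[Vo Vx OG] AB [cS dO] bS cO]]]] := H.
  exists V, A, B; split => //; exists (nodal_set G u `&` V); split => //.
  have gr y : V y -> grad u y != 0.
    move=> /dO /eqP dy; apply/eqP => /rowP/(_ i); rewrite !mxE; exact: dy.
  split => //.
  - by exists x0.
  (* The solution itself is the analytic defining function of the hypersurface. *)
  - move=> x [[Gx ux] Ox']; exists V, u; split => //.
    + by move=> a Oa; apply: helmholtz_analytic Go uh _ _; exact: OG.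
    + apply/seteqP; split => [y [[[Gy uy] _] Oy]//|y [Oy uy]].
      by split => //; split => //; split => //; exact: OG.
    + by move=> y [_ /gr].
  - by exists V.
  - move=> y [Ny Oy]; split => // -[_ _ gy].
    by have := gr y Oy; rewrite gy eqxx.
move: du; rewrite neq_lt => /orP[du|du]; last exact: regular_point_pos.
(* A negative derivative is reduced to a positive one by passing to -u, which has the same zeros and
   domains; the form of a linear combination lets [C1_at_lin] apply. *)
pose v y := -1 * u y + 0 * u y.
have vE : v = fun y => - u y by apply/funext => y; rewrite /v mul0r addr0 mulN1r.
have vN : nodal_set G v = nodal_set G u.
  apply/seteqP; split => y [Gy]; rewrite vE => uy; split => //.
    by apply/eqP; rewrite -oppr_eq0 uy.
  by rewrite uy oppr0.
have pv j y : G y -> partial j v y = - partial j u y.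
  move=> Gy; have /derivableP D := (uC.2 j).1 y Gy.
  by rewrite vE; have [_] := is_deriveN D.
have vC : class_C 1 G v.
  have L l y : G y -> C1_at v y l.
    move=> Gy; have L : C1_at u y l.
      split; last exact: (uC.2 l).2.1.
      by apply: filterS (open_nbhs_nbhs (conj Go Gy)) => z; exact: (uC.2 l).1.
    exact: C1_at_lin.
  split.
    move=> y /uC.1 c; rewrite vE; exact: continuousN.
  move=> j; split; last split => //.
    by move=> y /(L j)[/nbhs_singleton].
  by move=> y /(L j)[].
have vx0 : v x0 = 0 by rewrite vE ux0 oppr0.
have [| V [A [B [V1 AB [cS dO] bS cO]]]] := regular_point_pos (i := i) Go vC Gx0 vx0.
  by rewrite pv // oppr_gt0.
have [_ _ OG] := V1.
exists V, A, B; rewrite vN in cS bS; split => //.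
- by rewrite /nodal_domain -vN.
- by split => // y Oy; rewrite -oppr_eq0 -pv; [exact: dO|exact: OG].
- by move=> y Oy uy; apply: cO => //; rewrite vE oppr_eq0.
Qed.

End NodalEdges.

(** * Cubes with at most one uncovered point in each planar section *)

Section PuncturedSlices.
Variables (R : realType) (N : nat).
Implicit Types (a x y z : 'rV[R]_N) (d e s t : R) (W : set 'rV[R]_N).

Lemma seg_monochrome W W' x y : open W -> open W' -> W `&` W' = set0 ->
  seg x y `<=` W `|` W' -> W x -> W y.
Proof.
move=> Wo Wo' WW' sW Wx.
suff E : seg x y `&` W = seg x y by have := seg_right x y; rewrite -E => -[].
apply: (@connected_seg _ _ x y); first by exists x; split => //; exact: seg_left.
  by exists W.
exists (~` W'); first exact: open_closedC.
apply/seteqP; split => z [sz].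
  by move=> Wz; split => // Wz'; have : (W `&` W') z by []; rewrite WW'.
by move=> nz; split => //; have [|/nz] := sW z sz.
Qed.

Variables (i j : 'I_N).
Hypothesis (ij : i != j).

Definition move_to s t y : 'rV[R]_N :=
  \row_l (if l == i then s else if l == j then t else y 0 l).

Lemma move_toE s t y l :
  move_to s t y 0 l = if l == i then s else if l == j then t else y 0 l.
Proof. by rewrite mxE. Qed.

Lemma move_to_id y : move_to (y 0 i) (y 0 j) y = y.
Proof.
by apply/rowP => l; rewrite move_toE; case: eqP => [->|_] //; case: eqP => [->|].
Qed.

Lemma move_to_cube a d s t y : cube a d y -> `|s - a 0 i| <= d ->
  `|t - a 0 j| <= d -> cube a d (move_to s t y).
Proof.
move=> yd sd td l; rewrite move_toE; case: eqP => [->|_] //.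
by case: eqP => [->|].
Qed.

Variables (a : 'rV[R]_N) (d : R) (W W' : set 'rV[R]_N).
Hypotheses (d_gt0 : 0 < d) (W_open : open W) (W'_open : open W')
  (WW'0 : W `&` W' = set0)
  (uncovered_unique : forall y z, cube a d y -> cube a d z ->
     (forall l, l != i -> l != j -> y 0 l = z 0 l) ->
     ~ (W `|` W') y -> ~ (W `|` W') z -> y = z).

Let inI s := `|s - a 0 i| <= d.
Let inJ t := `|t - a 0 j| <= d.

Lemma between_close (c p q u : R) : `|p - c| <= d -> `|q - c| <= d -> 0 <= u <= 1 ->
  `|(1 - u) * p + u * q - c| <= d.
Proof.
move=> pd qd /andP[u0 u1]; have u1' : 0 <= 1 - u by lra.
have -> : (1 - u) * p + u * q - c = (1 - u) * (p - c) + u * (q - c) by ring.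
apply: le_trans (ler_normD _ _) _; rewrite !normrM (ger0_norm u0) (ger0_norm u1').
by have := ler_wpM2l u0 qd; have := ler_wpM2l u1' pd; lra.
Qed.

(** A reference point off both axis-parallel lines through the uncovered point (b1, b2). Every
    covered point of the slice reaches it by two axis-parallel segments avoiding (b1, b2), hence
    lies in the same one of W and W' as the reference point. *)
Lemma slice_center y : cube a d y -> exists s0 t0, [/\ inI s0, inJ t0 &
  forall s t, inI s -> inJ t ->
    (W (move_to s t y) -> W (move_to s0 t0 y)) /\
    (W' (move_to s t y) -> W' (move_to s0 t0 y))].
Proof.
move=> yd.
have [b1 [b2 [bad good]]] : exists b1 b2, (forall s t, inI s -> inJ t ->
      ~ (W `|` W') (move_to s t y) -> s = b1 /\ t = b2) /\
    (forall s t, inI s -> inJ t -> (W `|` W') (move_to s t y) -> s = b1 -> t != b2).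
  have [[[b1 b2] [ib jb nb]]|nb] := pselect (exists p : R * R,
      [/\ inI p.1, inJ p.2 & ~ (W `|` W') (move_to p.1 p.2 y)]).
    exists b1, b2; split => s t si tj.
      move=> nst; have E : move_to s t y = move_to b1 b2 y.
        apply: uncovered_unique => //; try exact: move_to_cube.
        by move=> l li lj; rewrite !move_toE (negPf li) (negPf lj).
      have := congr1 (fun M : 'rV_N => M 0 i) E; have := congr1 (fun M : 'rV_N => M 0 j) E.
      by rewrite !move_toE eqxx eq_sym (negPf ij) eqxx.
    by move=> cov E; apply/eqP => E2; apply: nb; rewrite -E -E2.
  (* No uncovered point: b1 is placed outside the range of s, so that s = b1 never happens, and b2
     is arbitrary. *)
  exists (a 0 i + 2 * d), 0; split => s t si tj.
    by move=> nst; exfalso; apply: nb; exists (s, t).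
  move=> _ E; exfalso; move: si; rewrite /inI E addrAC subrr add0r.
  by rewrite gtr0_norm ?mulr_gt0 //; have := d_gt0; lra.
have [s0 [s0i s0b]] : exists s0, inI s0 /\ s0 != b1.
  have [E|nE] := eqVneq b1 (a 0 i).
    exists (a 0 i + d); rewrite /inI addrAC subrr add0r gtr0_norm //; split => //.
    by rewrite E -subr_eq0 addrAC subrr add0r gt_eqF.
  by exists (a 0 i); rewrite /inI subrr normr0 ltW // eq_sym.
have [t0 [t0j t0b]] : exists t0, inJ t0 /\ t0 != b2.
  have [E|nE] := eqVneq b2 (a 0 j).
    exists (a 0 j + d); rewrite /inJ addrAC subrr add0r gtr0_norm //; split => //.
    by rewrite E -subr_eq0 addrAC subrr add0r gt_eqF.
  by exists (a 0 j); rewrite /inJ subrr normr0 ltW // eq_sym.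
exists s0, t0; split => // s t si tj.
have cov s' t' : inI s' -> inJ t' -> (s' != b1) || (t' != b2) ->
    (W `|` W') (move_to s' t' y).
  move=> si' tj' ne; apply: contrapT => /(bad _ _ si' tj')[E1 E2].
  by rewrite E1 E2 !eqxx in ne.
have segE s1 t1 s2 t2 z : seg (move_to s1 t1 y) (move_to s2 t2 y) z ->
    exists2 u, 0 <= u <= 1 &
      z = move_to ((1 - u) * s1 + u * s2) ((1 - u) * t1 + u * t2) y.
  move=> [u /= + <-]; rewrite in_itv /= => u01; exists u => //.
  apply/rowP => l; rewrite lerp_coord !move_toE.
  by case: eqP => // _; case: eqP => // _; ring.
have moveJ s1 t1 t2 : inI s1 -> inJ t1 -> inJ t2 -> s1 != b1 ->
    seg (move_to s1 t1 y) (move_to s1 t2 y) `<=` W `|` W'.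
  move=> i1 j1 j2 n1 z /segE[u u01 ->].
  have -> : (1 - u) * s1 + u * s1 = s1 by ring.
  by apply: cov => //; [exact: between_close|rewrite n1].
have moveI s1 s2 t1 : inI s1 -> inI s2 -> inJ t1 -> t1 != b2 ->
    seg (move_to s1 t1 y) (move_to s2 t1 y) `<=` W `|` W'.
  move=> i1 j1 j2 n1 z /segE[u u01 ->].
  have -> : (1 - u) * t1 + u * t1 = t1 by ring.
  by apply: cov => //; [exact: between_close|rewrite n1 orbT].
(* If s = b1 then t differs from b2, and s has to be moved first; otherwise t is moved first. Stated
   for a pair X, X' so as to serve W and W' in either order. *)
have reach X X' : open X -> open X' -> X `&` X' = set0 -> X `|` X' = W `|` W' ->
    X (move_to s t y) -> X (move_to s0 t0 y).
  move=> Xo Xo' XX' XU Xst.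
  have [sb|sb] := eqVneq s b1.
    have tb : t != b2.
      by apply: (good s t) => //; rewrite -XU; left.
    have : X (move_to s0 t y).
      by apply: seg_monochrome XX' _ Xst => //; rewrite XU; exact: moveI.
    by apply: seg_monochrome XX' _ => //; rewrite XU; exact: moveJ.
  have : X (move_to s t0 y).
    by apply: seg_monochrome XX' _ Xst => //; rewrite XU; exact: moveJ.
  by apply: seg_monochrome XX' _ => //; rewrite XU; exact: moveI.
split; first exact: (reach W W').
by apply: (reach W' W) => //; [rewrite setIC|exact: setUC].
Qed.

Definition slice_meets (X : set 'rV[R]_N) : set 'rV[R]_N :=
  [set y | exists s t, [/\ inI s, inJ t & X (move_to s t y)]].

Lemma open_slice_meets X : open X -> open (slice_meets X).
Proof.
move=> Xo; apply: open_of_cube => y [s [t [si tj Xy]]].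
have [e e0 eX] := open_cubeP Xo Xy; exists e => // z ze.
exists s, t; split => //; apply: eX => l; rewrite !move_toE.
case: eqP => _; first by rewrite subrr normr0 ltW.
by case: eqP => _; [rewrite subrr normr0 ltW|exact: ze].
Qed.

(** Within a slice only one of W and W' occurs, so the cube is the disjoint union of the slices
    meeting W and those meeting W'. Both parts are relatively open, and the cube is connected. *)
Lemma cube_monochrome : (forall y, cube a d y -> ~ W y) \/ (forall y, cube a d y -> ~ W' y).
Proof.
have self X y : cube a d y -> X y -> slice_meets X y.
  by move=> yd Xy; exists (y 0 i), (y 0 j); split; rewrite ?move_to_id //; exact: yd.
have disj y : cube a d y -> slice_meets W y -> slice_meets W' y -> False.
  move=> yd [s [t [si tj Wy]]] [s' [t' [si' tj' Wy']]].
  have [s0 [t0 [_ _ H]]] := slice_center yd.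
  have h1 := (H s t si tj).1 Wy; have h2 := (H s' t' si' tj').2 Wy'.
  by have : (W `&` W') (move_to s0 t0 y) by []; rewrite WW'0.
have cover y : cube a d y -> slice_meets W y \/ slice_meets W' y.
  move=> yd; have [Wy|nWy] := pselect ((W `|` W') y).
    by case: Wy => [Wy|Wy]; [left|right]; exact: self.
  (* An uncovered y is moved in direction i to another point of its slice inside the cube; that
     point is covered, by uniqueness. *)
  pose s := if y 0 i == a 0 i then a 0 i + d else a 0 i.
  have si : inI s.
    rewrite /inI /s; case: ifP => _; last by rewrite subrr normr0 ltW.
    by rewrite addrAC subrr add0r gtr0_norm.
  have tj := yd j.
  have [Wz|nWz] := pselect ((W `|` W') (move_to s (y 0 j) y)).
    by case: Wz => [Wz|Wz]; [left|right]; exists s, (y 0 j).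
  have E : y = move_to s (y 0 j) y.
    apply: uncovered_unique => //; first exact: move_to_cube.
    by move=> l li lj; rewrite move_toE (negPf li) (negPf lj).
  have := congr1 (fun M : 'rV_N => M 0 i) E; rewrite move_toE eqxx /s.
  case: eqP => [->|ne] /eqP.
    by rewrite -subr_eq0 opprD addNKr oppr_eq0 gt_eqF.
  by move/eqP/ne.
have [[y0 [y0d Wy0]]|nW] := pselect (exists y, cube a d y /\ W y); last first.
  by left => y yd Wy; apply: nW; exists y.
right => y yd Wy'.
suff E : cube a d `&` slice_meets W = cube a d.
  apply: (disj y yd); last exact: self.
  by have : cube a d y by []; rewrite -{1}E => -[].
apply: (connected_convex (@convex_cube _ _ a d)).
- by exists y0; split => //; exact: self.
- by exists (slice_meets W) => //; exact: open_slice_meets.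
- exists (~` slice_meets W'); first by apply: open_closedC; exact: open_slice_meets.
  apply/seteqP; split => z [zd Wz]; split => //.
    by move=> Wz'; exact: (disj z).
  by have [|/Wz] := cover z zd.
Qed.

End PuncturedSlices.

(** * Hessians at critical zeros *)

Section CriticalPoints.
Variables (R : realType) (N : nat).
Implicit Types (G : set 'rV[R]_N) (x y z : 'rV[R]_N) (d e : R) (f u : 'rV[R]_N -> R).

(** The off-diagonal entries b' and b'' vary independently, because the mean value theorem evaluates
    the two rows of the Hessian at different points. *)
Lemma det2_stable (a b c : R) : a * c - b ^+ 2 != 0 -> exists2 e, 0 < e &
  forall a' b' b'' c', `|a' - a| < e -> `|b' - b| < e -> `|b'' - b| < e ->
    `|c' - c| < e -> a' * c' - b' * b'' != 0.
Proof.
(* The determinant moves by at most e (|a| + |c| + 2 |b| + 2); one more unit in S makes the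
   inequality strict. *)
move=> D0; pose S : R := `|a| + `|c| + 2 * `|b| + 3.
have S0 : 2 <= S by rewrite /S; have := normr_ge0 a; have := normr_ge0 b; have := normr_ge0 c; lra.
have D1 : 0 < `|a * c - b ^+ 2| by rewrite normr_gt0.
pose e := Num.min 1 (`|a * c - b ^+ 2| / S).
have e0 : 0 < e by rewrite lt_min ltr01 divr_gt0 //; lra.
have := lexx e; rewrite {2}/e le_min => /andP[e1 eD].
rewrite ler_pdivlMr in eD; last by lra.
exists e => // a' b' b'' c' ha hb hb' hc; apply/eqP => E.
have : `|a * c - b ^+ 2| < `|a * c - b ^+ 2|; last by rewrite ltxx.
have {1}-> : a * c - b ^+ 2 = - ((a' - a) * c + a' * (c' - c)) +
    ((b' - b) * b + b' * (b'' - b)).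
  by have -> : a * c - b ^+ 2 = a * c - b ^+ 2 - (a' * c' - b' * b''); [rewrite E subr0|ring].
have bnd (p q : R) : `|p - q| < e -> `|p| <= `|q| + 1.
  move=> h; have -> : p = q + (p - q) by ring.
  by apply: le_trans (ler_normD _ _) _; rewrite lerD2l; lra.
have ea := bnd _ _ ha; have eb := bnd _ _ hb.
have M (p q t : R) : `|p| < e -> `|q| <= t -> `|p * q| <= e * t.
  by move=> pe qt; rewrite normrM; apply: ler_pM => //; exact: ltW.
have h1 := M _ _ _ ha (lexx `|c|); have h2 := M _ _ _ hc ea.
have h3 := M _ _ _ hb (lexx `|b|); have h4 := M _ _ _ hb' eb.
rewrite (mulrC a') (mulrC b').
apply: le_lt_trans (ler_normD _ _) _; rewrite normrN.
apply: le_lt_trans (lerD (ler_normD _ _) (ler_normD _ _)) _.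
have SE : e * S = e * `|c| + e * (`|a| + 1) + (e * `|b| + e * (`|b| + 1)) + e.
  by rewrite /S; ring.
by rewrite SE in eD; lra.
Qed.

Lemma sum_two (F : 'I_N -> R) i j : i != j ->
  (forall l, l != i -> l != j -> F l = 0) -> \sum_(l < N) F l = F i + F j.
Proof.
move=> ij F0; rewrite (bigD1 i) //= (bigD1 j) /=; last by rewrite eq_sym.
by rewrite big1 ?addr0 // => l /andP[li lj]; exact: F0.
Qed.

(** The mean value theorem for both partial derivatives on the segment from y to z gives a
    homogeneous 2 x 2 system for the i-th and j-th increments; its determinant is close to the minor
    at x0, hence nonzero. *)
Lemma hessian_injective G u i j x0 : open G -> class_C 2 G u -> G x0 -> i != j ->
  partial i (partial i u) x0 * partial j (partial j u) x0
    - partial i (partial j u) x0 ^+ 2 != 0 ->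
  exists2 d, 0 < d & cube x0 d `<=` G /\
    forall y z, cube x0 d y -> cube x0 d z ->
      (forall l, l != i -> l != j -> y 0 l = z 0 l) ->
      partial i u y = 0 -> partial j u y = 0 ->
      partial i u z = 0 -> partial j u z = 0 -> y = z.
Proof.
move=> Go uC Gx0 ij D0.
have [e e0 stable] := det2_stable D0.
have [d0 d00 dG] := open_cubeP Go Gx0.
have cts l m : exists2 d, 0 < d & forall y, cube x0 d y ->
    `|partial l (partial m u) y - partial l (partial m u) x0| < e.
  exact: ((continuous_cubeP _ _).1 (((uC.2 m).2.2 l).2.1 _ Gx0) e e0).
have [d1 d10 H1] := cts i i; have [d2 d20 H2] := cts i j; have [d3 d30 H3] := cts j j.
pose d := Num.min (Num.min d0 d1) (Num.min d2 d3).
have dd0 : 0 < d by rewrite !lt_min d00 d10 d20.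
exists d => //.
have [s0 s1 s2 s3] : [/\ d <= d0, d <= d1, d <= d2 & d <= d3].
  by split; rewrite !ge_min lexx ?orbT.
clearbody d.
have cG : cube x0 d `<=` G by move=> y yd; apply: dG; exact: cubeS yd.
split => // y z yd zd slice yi yj zi zj.
pose p := z 0 i - y 0 i; pose q := z 0 j - y 0 j.
have zyE l : (z - y) 0 l = z 0 l - y 0 l by rewrite !mxE.
have along m : partial m u y = 0 -> partial m u z = 0 -> exists2 xi, cube x0 d xi &
    p * partial i (partial m u) xi + q * partial j (partial m u) xi = 0.
  move=> ym zm.
  have mC : class_C 1 G (partial m u) := (uC.2 m).2.
  have inc (t : R) : 0 <= t <= 1 -> cube x0 d (y + t *: (z - y)).
    by move=> t01; apply: (convex_cube yd zd); exists t; rewrite //= in_itv.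
  have sub (t : R) : t \in `[0, 1] -> 0 <= t <= 1 by rewrite in_itv.
  pose g (t : R) := \sum_(l < N) (z - y) 0 l * partial l (partial m u) (y + t *: (z - y)).
  have D (t : R) : 0 <= t <= 1 -> is_derive t 1 (fun s : R => partial m u (y + s *: (z - y))) (g t).
    by move=> t01; apply: is_derive_along Go mC _; apply: cG; exact: inc.
  have D' (t : R) : t \in `]0, 1[ -> is_derive t 1 (fun s : R => partial m u (y + s *: (z - y))) (g t).
    by move/subset_itv_oo_cc/sub; exact: D.
  have W : {within `[0, 1], continuous (fun s : R => partial m u (y + s *: (z - y)))}.
    by apply: derivable_within_continuous => t /sub /D [].
  have [t /subset_itv_oo_cc/sub t01] := MVT ltr01 D' W.
  rewrite scale1r scale0r addr0 (addrC y) subrK ym zm subrr subr0 mulr1 => /esym E.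
  exists (y + t *: (z - y)); first exact: inc.
  rewrite -E /p /q -!zyE; apply/esym/sum_two => // l li lj.
  by rewrite zyE (slice l li lj) subrr mul0r.
have [x1 x1d E1] := along i yi zi; have [x2 x2d E2] := along j yj zj.
have sym x : cube x0 d x -> partial j (partial i u) x = partial i (partial j u) x.
  by move=> /cG Gx; exact: partial_comm Go Gx uC.
have det := stable (partial i (partial i u) x1) (partial j (partial i u) x1)
  (partial i (partial j u) x2) (partial j (partial j u) x2).
have {}det : partial i (partial i u) x1 * partial j (partial j u) x2
    - partial j (partial i u) x1 * partial i (partial j u) x2 != 0.
  apply: det.
  - by apply: H1; exact: cubeS x1d.
  - by rewrite sym //; apply: H2; exact: cubeS x1d.
  - by apply: H2; exact: cubeS x2d.
  - by apply: H3; exact: cubeS x2d.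
move: det E1 E2; move: (partial i _ x1) (partial j _ x1) (partial i _ x2) (partial j _ x2).
move=> A B B' C det E1 E2.
have p0 : p = 0.
  apply/eqP; rewrite -(mulrI_eq0 _ (mulfI det)).
  have -> : (A * C - B * B') * p = C * (p * A + q * B) - B * (p * B' + q * C) by ring.
  by rewrite E1 E2 !mulr0 subrr.
have q0 : q = 0.
  apply/eqP; rewrite -(mulrI_eq0 _ (mulfI det)).
  have -> : (A * C - B * B') * q = A * (p * B' + q * C) - B' * (p * A + q * B) by ring.
  by rewrite E1 E2 !mulr0 subrr.
apply/rowP => l; have [->|li] := eqVneq l i.
  by apply/esym/eqP; rewrite -subr_eq0 -/p p0.
have [->|lj] := eqVneq l j; last exact: slice.
by apply/esym/eqP; rewrite -subr_eq0 -/q q0.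
Qed.

(* The Hessian at a zero of u is traceless, so it has a nonzero principal
   2 x 2 minor as soon as it is nonzero. *)
Lemma traceless_minor k G u l m x0 : open G -> helmholtz_solution G k u -> G x0 ->
  u x0 = 0 -> partial l (partial m u) x0 != 0 ->
  exists i j, i != j /\
    partial i (partial i u) x0 * partial j (partial j u) x0
      - partial i (partial j u) x0 ^+ 2 != 0.
Proof.
move=> Go uh Gx0 ux0 lm.
have tr : \sum_(i < N) partial i (partial i u) x0 = 0.
  by have := uh.2 x0 Gx0; rewrite /laplacian ux0 mulr0 addr0.
have [[i ii]|diag] := pselect (exists i, partial i (partial i u) x0 != 0); last first.
  have d0 i : partial i (partial i u) x0 = 0.
    by apply/eqP/negPn/negP => ii; apply: diag; exists i.
  exists l, m; split; last by rewrite d0 mul0r sub0r oppr_eq0 expf_neq0.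
  by apply/eqP => E; rewrite E d0 eqxx in lm.
(* If all minors with row i vanished, each d_ii d_jj would be a square, and d_ii times the trace
   would be at least d_ii^2 > 0. *)
exists i; apply: contrapT => H.
have minor j : j != i -> 0 <= partial i (partial i u) x0 * partial j (partial j u) x0.
  move=> ji; have -> : partial i (partial i u) x0 * partial j (partial j u) x0
      = partial i (partial j u) x0 ^+ 2; last exact: sqr_ge0.
  apply/eqP; rewrite -subr_eq0; apply/negPn/negP => D; apply: H; exists j.
  by split => //; rewrite eq_sym.
have : 0 < partial i (partial i u) x0 * \sum_(j < N) partial j (partial j u) x0.
  rewrite (bigD1 i) //= mulrDr ltr_wpDr //; last by rewrite -expr2 exprn_even_gt0.
  by rewrite mulr_sumr; apply: sumr_ge0.
by rewrite tr mulr0 ltxx.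
Qed.

End CriticalPoints.

(** * Connectedness of the graph of nodal domains *)

Section NodalGraph.
Variables (R : realType) (N : nat) (G : set 'rV[R]_N) (k : R) (u : 'rV[R]_N -> R).
Implicit Types (x y z : 'rV[R]_N) (d e : R) (A B : set 'rV[R]_N).
Hypotheses (G_open : open G) (G_connected : connected G)
  (u_solution : helmholtz_solution G k u)
  (u_nontrivial : exists x, G x /\ u x <> 0).

Let nodal_domain := nodal_domain G u.

Lemma open_nodal_complement : open (G `\` nodal_set G u).
Proof.
apply: open_nonzero => //; case: u_solution => -[c u1] _.
by split => // j; split; [exact: (u1 j).1|split => //; exact: (u1 j).2.1].
Qed.

Lemma nodal_domainE A y : nodal_domain A -> A y ->
  A = connected_component (G `\` nodal_set G u) y.
Proof. by move=> [x _ ->] xy; exact: same_connected_component. Qed.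

Lemma nodal_domain_eq A B y : nodal_domain A -> nodal_domain B -> A y -> B y -> A = B.
Proof. by move=> nA nB /(nodal_domainE nA) -> /(nodal_domainE nB) ->. Qed.

Lemma nodal_domain_sub A : nodal_domain A -> A `<=` G `\` nodal_set G u.
Proof. by move=> [x _ ->]; exact: connected_component_sub. Qed.

Lemma open_nodal_domain A : nodal_domain A -> open A.
Proof. by move=> [x _ ->]; apply: open_component; exact: open_nodal_complement. Qed.

Lemma nodal_domain_point y : G y -> u y != 0 ->
  nodal_domain (connected_component (G `\` nodal_set G u) y) /\
  connected_component (G `\` nodal_set G u) y y.
Proof.
move=> Gy uy; have ny : (G `\` nodal_set G u) y.
  by split => // -[_ E]; rewrite E eqxx in uy.
by split; [exists y|exact: connected_component_refl].
Qed.

Definition family_union (P : set (set 'rV[R]_N)) : set 'rV[R]_N :=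
  [set x | exists A, [/\ nodal_domain A, P A & A x]].

Definition surrounded_by (P : set (set 'rV[R]_N)) : set 'rV[R]_N :=
  [set x | G x /\ exists2 d, 0 < d & forall y, cube x d y -> ~ family_union (~` P) y].

Lemma open_surrounded_by P : open (surrounded_by P).
Proof.
apply: open_of_cube => x [Gx [d d0 H]].
have [d' d'0 dG] := open_cubeP G_open Gx.
pose e := Num.min d d' / 2.
have m0 : 0 < Num.min d d' by rewrite lt_min d0.
have e0 : 0 < e by rewrite divr_gt0.
have [e1 e2] : e + e <= d /\ e + e <= d'.
  have -> : e + e = Num.min d d' by rewrite /e; field.
  by rewrite !ge_min !lexx orbT.
exists e => // y ye; split; first by apply: dG; apply: cubeS ye; lra.
exists e => // z zy; apply: H; exact: cubeS (cube_trans ye zy).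
Qed.

Lemma family_union_sub P : family_union P `<=` surrounded_by P.
Proof.
move=> x [A [nA PA Ax]]; split; first by case: (nodal_domain_sub nA Ax).
have [d d0 dA] := open_cubeP (open_nodal_domain nA) Ax.
exists d => // y /dA Ay [B [nB nPB By]]; apply: nPB.
by rewrite -(nodal_domain_eq nA nB Ay By).
Qed.

Lemma family_union_cover P y : G y -> u y != 0 -> family_union P y \/ family_union (~` P) y.
Proof.
move=> Gy uy; have [nA Ay] := nodal_domain_point Gy uy.
by have [PA|nPA] := pselect (P (connected_component (G `\` nodal_set G u) y));
  [left|right]; eexists; split; eauto.
Qed.

(** Every neighbourhood of a point of G contains a nonzero of u, whose domain is either in P or
    outside it. *)
Lemma surrounded_by_disjoint P : surrounded_by P `&` surrounded_by (~` P) = set0.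
Proof.
apply/seteqP; split => // x [[Gx [d d0 H]] [_ [d' d'0 H']]].
have m0 : 0 < Num.min d d' by rewrite lt_min d0.
have [y [yd Gy uy]] := nonzero_near G_open G_connected u_solution u_nontrivial Gx m0.
have [Uy|Uy] := family_union_cover P Gy uy.
  apply: (H' y); last by rewrite setCK.
  by apply: cubeS yd; rewrite ge_min lexx orbT.
by apply: (H y) Uy; apply: cubeS yd; rewrite ge_min lexx.
Qed.

Variable P : set (set 'rV[R]_N).
Hypothesis P_edge : forall A B, nodal_domain A -> nodal_domain B -> P A ->
  nodal_edge G u A B -> P B.

Lemma surrounded_by_cover m x : G x ->
  (exists w, size w = m /\ dpart w u x != 0) ->
  (surrounded_by P `|` surrounded_by (~` P)) x.
Proof.
elim/ltn_ind: m x => m IH x Gx [w [wm wx]].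
(* A shorter word falls under the induction; otherwise m is the exact order of vanishing. *)
have [[w' [w'm w'x]]|low] := pselect (exists w', (size w' < m)%N /\ dpart w' u x != 0).
  by apply: IH w'm _ Gx _; exists w'.
have {}low w' : (size w' < m)%N -> dpart w' u x = 0.
  by move=> w'm; apply/eqP/negPn/negP => w'x; apply: low; exists w'.
case: w wm wx => [|i [|j w]] /= wm wx.
- by have [Ux|Ux] := family_union_cover P Gx wx; [left|right]; exact: family_union_sub.
- have ux : u x = 0 by apply: (low [::]); rewrite -wm.
  have [V [A [B [Vo Vx [nA nB] AB cov]]]] := regular_point G_open u_solution Gx ux wx.
  have [d d0 dV] := open_cubeP Vo Vx.
  have near y Q : cube x d y -> family_union Q y -> Q A \/ Q B.
    move=> /dV Vy [C [nC QC Cy]].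
    have uy : u y != 0.
      have [Gy ny] := nodal_domain_sub nC Cy.
      by apply/eqP => uy; apply: ny.
    by have [Ay|By] := cov y Vy uy; [left|right];
      [rewrite (nodal_domain_eq nA nC Ay Cy)|rewrite (nodal_domain_eq nB nC By Cy)].
  have PAB : P A <-> P B.
    by split => ?; [apply: P_edge nA nB _ AB|apply: P_edge nB nA _ (nodal_edge_sym AB)].
  have [PA|nPA] := pselect (P A).
    left; split => //; exists d => // y yd /(near _ _ yd)[|] //.
    by apply; apply/PAB.
  right; split => //; exists d => // y yd; rewrite setCK => /(near _ _ yd)[|] //.
  by move/PAB.
(* Here m >= 2 and [w] has lost its two outermost letters: [dpart w u] vanishes at x, but its
   Hessian has the nonzero entry (i, j). *)
have wx0 : dpart w u x = 0 by apply: low; rewrite -wm ltnW.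
have wh := helmholtz_dpart w G_open u_solution.
have [a [b [ab D0]]] := traceless_minor G_open wh Gx wx0 wx.
have [d d0 [dG inj]] := hessian_injective G_open wh.1 Gx ab D0.
(* A nonzero [partial l (dpart w u) y] is the derivative for the word [l :: w], of length m - 1, so
   that the induction covers y. *)
have bad y l : cube x d y -> ~ (surrounded_by P `|` surrounded_by (~` P)) y ->
    partial l (dpart w u) y = 0.
  move=> /dG Gy ny; apply/eqP/negPn/negP => ly; apply: ny.
  by apply: (IH (size w).+1) => //; [rewrite -wm|exists (l :: w)].
have [] := @cube_monochrome R N a b ab x d (surrounded_by P) (surrounded_by (~` P)) d0
  (@open_surrounded_by P) (@open_surrounded_by (~` P)) (surrounded_by_disjoint P).
- by move=> y z yd zd yz ny nz; apply: inj => //; exact: bad.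
- move=> H; right; split => //; exists d => // y /H Wy Uy; apply: Wy.
  by apply: family_union_sub; move: Uy; rewrite setCK.
- move=> H; left; split => //; exists d => // y /H Wy Uy; apply: Wy.
  exact: family_union_sub.
Qed.

Lemma nodal_graph_connected : (exists A, nodal_domain A /\ P A) ->
  forall B, nodal_domain B -> P B.
Proof.
move=> [A [nA PA]] B nB; apply: contrapT => nPB.
have [a Aa] : exists a, A a.
  by case: nA => a na ->; exists a; exact: connected_component_refl.
have [b Bb] : exists b, B b.
  by case: nB => b nb ->; exists b; exact: connected_component_refl.
have E : surrounded_by P = G.
  apply: G_connected.
  - by exists a; apply: family_union_sub; exists A.
  - exists (surrounded_by P); first exact: open_surrounded_by.
    by apply/seteqP; split => [x [Gx ?]//|x []].
  - exists (~` surrounded_by (~` P)); first by apply: open_closedC; exact: open_surrounded_by.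
    apply/seteqP; split => [x Wx|x [Gx nW]].
      split; first by case: Wx.
      move=> Wx'; have : (surrounded_by P `&` surrounded_by (~` P)) x by [].
      by rewrite surrounded_by_disjoint.
    have [w wx] := unique_continuation G_open G_connected u_solution u_nontrivial Gx.
    by have [|//|/nW] := @surrounded_by_cover (size w) x Gx; first by exists w.
have [Gb _] := nodal_domain_sub nB Bb.
have : surrounded_by P b by rewrite E.
move=> [_ [d d0 /(_ b (cube_center _ (ltW d0)))]]; apply.
by exists B.
Qed.

End NodalGraph.

(** * Greedy listing of a countable connected graph *)

Section GreedyEnumeration.
Variables (T : eqType) (D : T -> Prop) (E : T -> T -> Prop) (code : T -> nat) (A0 : T).
Implicit Types (A B : T) (s : seq T) (n m : nat).
Hypotheses (code_inj : forall A B, D A -> D B -> code A = code B -> A = B)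
  (D_A0 : D A0)
  (D_connected : forall P : T -> Prop,
     (forall A B, D A -> D B -> P A -> E A B -> P B) ->
     (exists A, D A /\ P A) -> forall B, D B -> P B).

Definition candidate s B : Prop :=
  [/\ D B, B \notin s & exists A, A \in s /\ E A B].

Lemma least_candidate s : exists o : option T,
  if o is Some B then candidate s B /\ forall B', candidate s B' -> (code B <= code B')%N
  else forall B, ~ candidate s B.
Proof.
have [[B0 cB0]|no] := pselect (exists B, candidate s B); last first.
  by exists None => B cB; apply: no; exists B.
have H n : forall B, candidate s B -> (code B <= n)%N -> exists B', candidate s B' /\
    forall B'', candidate s B'' -> (code B' <= code B'')%N.
  elim: n => [|n IH] B cB Bn.
    by exists B; split => // B'' _; apply: leq_trans Bn _.
  have [[B' [cB' lt]]|no] := pselect (exists B', candidate s B' /\ (code B' < code B)%N).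
    by apply: (IH B' cB'); rewrite -ltnS; exact: leq_trans lt Bn.
  exists B; split => // B'' cB''; rewrite leqNgt; apply/negP => lt.
  by apply: no; exists B''.
by have [B HB] := H _ B0 cB0 (leqnn _); exists (Some B).
Qed.

(** The candidate of least code is taken, so that no neighbour can be postponed for ever. *)
Definition next s : option T := sval (cid (least_candidate s)).

Lemma nextP s : if next s is Some B
  then candidate s B /\ forall B', candidate s B' -> (code B <= code B')%N
  else forall B, ~ candidate s B.
Proof. by rewrite /next; case: cid. Qed.

(** Stage n has n + 1 elements as long as candidates exist and is constant afterwards; this covers
    finite and infinite graphs alike. *)
Fixpoint stage n : seq T :=
  if n is m.+1 then if next (stage m) is Some B then rcons (stage m) B else stage m
  else [:: A0].

Lemma stage_prefix n m i : (n <= m)%N -> (i < size (stage n))%N ->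
  (i < size (stage m))%N /\ nth A0 (stage m) i = nth A0 (stage n) i.
Proof.
move=> nm im; elim: m nm => [|m IH]; first by rewrite leqn0 => /eqP <-.
rewrite leq_eqVlt => /orP[/eqP <- //|]; rewrite ltnS => /IH[h1 h2] /=.
case: (next _) => // B; rewrite size_rcons nth_rcons h1 h2; split => //.
exact: leqW.
Qed.

Lemma stage_uniq n : uniq (stage n).
Proof.
elim: n => //= n IH; have := nextP (stage n).
by case: (next _) => // B [[_ nB _] _]; rewrite rcons_uniq nB.
Qed.

Lemma stage_D n A : A \in stage n -> D A.
Proof.
elim: n => /= [|n IH]; first by rewrite inE => /eqP ->.
have := nextP (stage n); case: (next _) => // B [[DB _ _] _].
by rewrite mem_rcons inE => /orP[/eqP ->|/IH].
Qed.

Lemma stage_edge n i : (0 < i < size (stage n))%N ->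
  exists2 i', (i' < i)%N & E (nth A0 (stage n) i') (nth A0 (stage n) i).
Proof.
elim: n => /= [|n IH]; first by case: i => [|[]].
have := nextP (stage n); case: (next _) => // B [[_ _ [A [As AB]]] _].
move=> /andP[i0]; rewrite size_rcons ltnS leq_eqVlt => /orP[/eqP i_size|h]; last first.
  have [|i' ii EE] := IH; first by rewrite i0.
  by exists i' => //; rewrite !nth_rcons h (ltn_trans ii h).
exists (index A (stage n)); first by rewrite i_size index_mem.
by rewrite !nth_rcons index_mem As nth_index // -i_size ltnn eqxx.
Qed.

Lemma stage_size_or n : size (stage n) = n.+1 \/ next (stage n) = None.
Proof.
elim: n => [|n [IH|IH]] /=; first by left.
  by case e : (next _) => [B|]; [left; rewrite size_rcons IH|right].
by right; rewrite IH.
Qed.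

Lemma stage_size n i : (i < size (stage n))%N -> size (stage i) = i.+1.
Proof.
elim: n => /= [|n IH]; first by rewrite ltnS leqn0 => /eqP ->.
case e : (next (stage n)) => [B|//]; have [sn|] := stage_size_or n; last by rewrite e.
rewrite size_rcons ltnS leq_eqVlt => /orP[/eqP -> |//].
by rewrite sn /= e size_rcons sn.
Qed.

(* Otherwise a neighbour B of the enumerated part would remain a candidate
   for ever, and infinitely many elements would have code at most that of B. *)
Lemma stage_exhausts B : D B -> exists n, B \in stage n.
Proof.
move: B; apply: (D_connected (P := fun B => exists n, B \in stage n)); last first.
  by exists A0; split => //; exists 0%N; rewrite inE.
move=> A B DA DB [n An] AB; apply: contrapT => nB.
have H m : exists t, [/\ stage (n + m) = stage n ++ t, size t = m &
    all (fun C => code C <= code B)%N t].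
  elim: m => [|m [t [st tm tB]]]; first by exists [::]; rewrite addn0 cats0.
  have cB : candidate (stage (n + m)) B.
    split => //; first by apply/negP => Bs; apply: nB; exists (n + m)%N.
    by exists A; rewrite st mem_cat An.
  have := nextP (stage (n + m)); rewrite addnS /=; case: (next _) => [C [_ /(_ B cB) CB]|/(_ B)//].
  exists (rcons t C); rewrite st rcons_cat size_rcons tm; split => //.
  by rewrite all_rcons CB.
(* Only code B + 1 codes are at most that of B, so code B + 2 further distinct elements are too
   many. *)
have [t [st tm tB]] := H (code B).+2.
have U : uniq (map code t).
  have := stage_uniq (n + (code B).+2); rewrite st cat_uniq => /and3P[_ _ ut].
  rewrite map_inj_in_uniq // => C C' Ct C't.
  by apply: code_inj; apply: (@stage_D (n + (code B).+2)); rewrite st mem_cat ?Ct ?C't orbT.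
have := uniq_leq_size U (_ : {subset map code t <= iota 0 (code B).+1}).
rewrite size_map tm size_iota ltnn => F; apply/notF/F => _ /mapP[C Ct ->].
by rewrite mem_iota /= add0n ltnS; exact: (allP tB).
Qed.

Lemma greedy_enumeration : exists (J : set nat) (A : nat -> T),
  [/\ sequence_index_set J, set_bij J D A &
    forall j, J j -> (2 <= j)%N -> exists2 i, (1 <= i < j)%N & E (A i) (A j)].
Proof.
(* Numbering starts at 1: the j-th element is at position j - 1, and j is an index when the list was
   still growing at stage j - 1. *)
pose J := [set j | (1 <= j)%N /\ size (stage j.-1) = j].
pose A j := nth A0 (stage j) j.-1.
have AE j m : J j -> (j.-1 <= m)%N -> (j.-1 < size (stage m))%N /\ A j = nth A0 (stage m) j.-1.
  move=> [j1 sj] jm; have lt : (j.-1 < size (stage j.-1))%N by rewrite sj ltn_predL.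
  have [h1 h2] := stage_prefix jm lt; have [h3 h4] := stage_prefix (leq_pred j) lt.
  by split => //; rewrite /A h4 h2.
exists J, A; split.
(* Either the list grows for ever and all j >= 1 are indices, or some stage n has stopped growing
   and its size is the last index. *)
- have [all_|] := pselect (forall n, size (stage n) = n.+1).
    left; apply/seteqP; split => [j []//|j /= j1]; split => //.
    by rewrite all_ prednK.
  move=> /existsNP[n sn]; right; exists (size (stage n)).
  apply/seteqP; split => [j [j1 sj]|j /= /andP[j1 jn]].
    apply/andP; split => //; have [jn|nj] := leqP j.-1 n.
      have lt : (j.-1 < size (stage j.-1))%N by rewrite sj ltn_predL.
      by have [] := stage_prefix jn lt; rewrite prednK.
    exfalso; apply: sn; apply: (@stage_size j.-1); rewrite sj.
    by apply: ltn_trans nj _; rewrite ltn_predL.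
  by split => //; rewrite (@stage_size n) prednK.
- split.
  + move=> j Jj; have [h ->] := AE j j.-1 Jj (leqnn _).
    by apply: (@stage_D j.-1); exact: mem_nth.
  + move=> j j' /set_mem Jj /set_mem Jj' AA.
    have [h1 e1] := AE j (maxn j.-1 j'.-1) Jj (leq_maxl _ _).
    have [h2 e2] := AE j' (maxn j.-1 j'.-1) Jj' (leq_maxr _ _).
    move: AA; rewrite e1 e2 => /eqP; rewrite nth_uniq ?stage_uniq // => /eqP jj.
    by case: Jj => j1 _; case: Jj' => j1' _; rewrite -(prednK j1) -(prednK j1') jj.
  + move=> B DB; have [n Bn] := stage_exhausts DB.
    have lt : (index B (stage n) < size (stage n))%N by rewrite index_mem.
    have Jj : J (index B (stage n)).+1 by split => //=; exact: stage_size lt.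
    exists (index B (stage n)).+1 => //.
    have [_ e] := stage_prefix (leq_maxl n (index B (stage n))) lt.
    have [_ ->] := AE _ _ Jj (leq_maxr n (index B (stage n))).
    by rewrite /= e nth_index.
- move=> j Jj j2; have [h1 e1] := AE j j Jj (leq_pred _).
  have [|i' ii' EE] := @stage_edge j j.-1; first by rewrite h1 andbT -ltnS prednK // ltnW.
  have lt := ltn_trans ii' h1.
  have Ji : J i'.+1 by split => //=; exact: stage_size lt.
  have i'j : (i' < j)%N by apply: leq_trans ii' (leq_pred _).
  exists i'.+1; first by rewrite /= -[j]prednK ?ltnS // ltnW.
  have [_ ->] := AE i'.+1 j Ji (ltnW i'j).
  by rewrite e1.
Qed.

End GreedyEnumeration.

(** * Countability of the nodal domains and conclusion *)

Lemma open_has_rational (R : realType) (N : nat) (A : set 'rV[R]_N) x : open A -> A x ->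
  exists q : 'rV[rat]_N, A (map_mx ratr q).
Proof.
move=> Ao Ax; have [d d0 dA] := open_cubeP Ao Ax.
have /choice[q qP] : forall j : 'I_N, exists q : rat, ratr q \in `]x 0 j - d, x 0 j + d[.
  by move=> j; apply: rat_in_itvoo; lra.
exists (\row_j q j); apply: dA => j; rewrite !mxE.
by have := qP j; rewrite in_itv /= => /andP[h1 h2]; rewrite ler_norml; lra.
Qed.

Unset Implicit Arguments.

Theorem proposition3p2 (R : realType) (N : nat) (hN : (2 <= N)%N)
    (G : set 'rV[R]_N) (G_open : open G) (G_connected : connected G)
    (k : R) (v : 'rV[R]_N -> R)
    (v_solution : helmholtz_solution G k v)
    (v_nontrivial : exists x, G x /\ v x <> 0) :
  exists (J : set nat) (A : nat -> set 'rV[R]_N),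
    [/\ sequence_index_set J,
        set_bij J [set D | nodal_domain G v D] A &
        forall j : nat, J j -> (2 <= j)%N ->
          exists (i : nat) (S : set 'rV[R]_N),
            [/\ (1 <= i < j)%N,
                regular_portion G v S &
                S `<=` boundary (A i) `&` boundary (A j)]].
Proof.
have [x0 [Gx0 vx0]] := v_nontrivial.
have [nA0 _] := nodal_domain_point Gx0 (introN eqP vx0).
(* A rational point chosen in each domain serves as its code; domains sharing a point are equal, so
   the code is injective on them. Other sets receive the dummy value 0. *)
have /choice[q qP] : forall A, exists q : 'rV[rat]_N,
    nodal_domain G v A -> A (map_mx ratr q).
  move=> A; have [nA|nA] := pselect (nodal_domain G v A); last by exists 0.
  have [x Ax] : exists x, A x.
    by case: nA => x nx ->; exists x; exact: connected_component_refl.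
  have [q Aq] := open_has_rational (open_nodal_domain G_open v_solution nA) Ax.
  by exists q.
have code_inj A B : nodal_domain G v A -> nodal_domain G v B ->
    choice.pickle (q A) = choice.pickle (q B) -> A = B.
  move=> nA nB /(pcan_inj (@choice.pickleK _)) qAB; apply: (nodal_domain_eq nA nB (qP A nA)).
  by rewrite qAB; exact: qP.
have [J [A [JP bij edge]]] := greedy_enumeration code_inj nA0
  (fun P PE PA => nodal_graph_connected G_open G_connected v_solution v_nontrivial PE PA).
exists J, A; split => // j Jj j2; have [i ij [S [Sr SA]]] := edge j Jj j2.
by exists i, S; split.
Qed.
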